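(* Let $\boldsymbol\theta=(\vartheta_1,\ldots,\vartheta_p)$ be the vector of model parameters, on which the generator blocks $\mathbf Q^{[n,n']}(\boldsymbol\theta)$ depend differentiably. Let $\mathcal{A}\subseteq\{0,1,\ldots,N\}$ and let $s\in\mathbb{C}$ with $\mathrm{Re}(s)\ge 0$ (such that the inverses displayed below exist). For $1\le n\le N$ and $2\le k\le n$, $$\frac{\partial}{\partial\boldsymbol\theta}\widetilde{\mathbf C}_{\mathcal{A}}^{n,n-k}(s;\boldsymbol\theta)=\frac{\partial \widetilde{\mathbf C}_{\mathcal{A}}^{n,n-k+1}(s;\boldsymbol\theta)}{\partial\boldsymbol\theta}\left(\mathbf I_p\otimes\widetilde{\mathbf C}_{\mathcal{A}}^{n-k+1,n-k}(s;\boldsymbol\theta)\right)+\widetilde{\mathbf C}_{\mathcal{A}}^{n,n-k+1}(s;\boldsymbol\theta)\,\frac{\partial\widetilde{\mathbf C}_{\mathcal{A}}^{n-k+1,n-k}(s;\boldsymbol\theta)}{\partial\boldsymbol\theta},$$ where, with $\mathbf M_N=\mathbf Q^{[N,N]}(\boldsymbol\theta)-s\,\mathbf C_N\,I(N\in\mathcal{A})$, $$\frac{\partial}{\partial\boldsymbol\theta}\widetilde{\mathbf C}_{\mathcal{A}}^{N,N-1}(s;\boldsymbol\theta)=\mathbf M_N^{-1}\,\frac{\partial\mathbf Q^{[N,N]}(\boldsymbol\theta)}{\partial\boldsymbol\theta}\left(\mathbf I_p\otimes\mathbf M_N^{-1}\right)\left(\mathbf I_p\otimes\mathbf Q^{[N,N-1]}(\boldsymbol\theta)\right)-\mathbf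 M_N^{-1}\,\frac{\partial\mathbf Q^{[N,N-1]}(\boldsymbol\theta)}{\partial\boldsymbol\theta},$$ and for $m=N-1,\ldots,n-k+1$, with $\mathbf M_m=\mathbf Q^{[m,m]}(\boldsymbol\theta)-s\,\mathbf C_m\,I(m\in\mathcal{A})+\mathbf Q^{[m,m+1]}(\boldsymbol\theta)\,\widetilde{\mathbf C}_{\mathcal{A}}^{m+1,m}(s;\boldsymbol\theta)$, $$\begin{aligned}\frac{\partial}{\partial\boldsymbol\theta}\widetilde{\mathbf C}_{\mathcal{A}}^{m,m-1}(s;\boldsymbol\theta)={}&\mathbf M_m^{-1}\left(\frac{\partial\mathbf Q^{[m,m]}(\boldsymbol\theta)}{\partial\boldsymbol\theta}+\frac{\partial\mathbf Q^{[m,m+1]}(\boldsymbol\theta)}{\partial\boldsymbol\theta}\left(\mathbf I_p\otimes\widetilde{\mathbf C}_{\mathcal{A}}^{m+1,m}(s;\boldsymbol\theta)\right)+\mathbf Q^{[m,m+1]}(\boldsymbol\theta)\,\frac{\partial\widetilde{\mathbf C}_{\mathcal{A}}^{m+1,m}(s;\boldsymbol\theta)}{\partial\boldsymbol\theta}\right)\\&\times\left(\mathbf I_p\otimes\mathbf M_m^{-1}\right)\left(\mathbf I_p\otimes\mathbf Q^{[m,m-1]}(\boldsymbol\theta)\right)-\mathbf M_m^{-1}\,\frac{\partial\mathbf Q^{[m,m-1]}(\boldsymbol\theta)}{\partial\boldsymbol\theta}.\end{aligned}$$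
   Context: Level-dependent quasi-birth-and-death process (LD-QBD): a continuous-time Markov chain $\{(X(t),\varphi(t)):t\ge 0\}$ on the finite state space $\mathcal{S}=\{(n,i): n=0,1,\ldots,N;\ i=0,1,\ldots,K_n\}$, with level $X(t)$ and phase $\varphi(t)$, such that each transition changes the level by at most one. Its generator $\mathbf Q=\mathbf Q(\boldsymbol\theta)$ (for each value of the real parameter vector $\boldsymbol\theta$ in an open set) has off-diagonal entries the transition rates $q_{(n,i)\to(n',j)}$ and diagonal entries $q_{(n,i)\to(n,i)}=-\sum_{(n',j)\ne(n,i)}q_{(n,i)\to(n',j)}$. It is block tridiagonal with blocks $\mathbf Q^{[n,n']}=[q_{(n,i)\to(n',j)}]_{i=0,\ldots,K_n;\,j=0,\ldots,K_{n'}}$, which are zero if $|n-n'|>1$ and may depend on $n$. Costs accrue at rate $c(n,i)\ge 0$ (not depending on $\boldsymbol\theta$) per unit time in state $(n,i)$; $\mathbf C_n=\mathrm{diag}(c(n,i))_{i}$. $I(\cdot)$ is the indicator ($1$ if the condition is true, $0$ otherwise). For a set of levels $\mathcal{A}\subseteq\{0,\ldots,N\}$, $$C_{\mathcal{A}}(t)=\int_0^t c(X(u),\varphi(u))\,I(X(u)\in\mathcal{A})\,du$$ is the total cost accumulated in $\mathcal A$ up to time $t$. The first hitting time of level $m$ is $\theta_m=\inf\{t>0: X(t)=m\}$. For $1\le k\le n$, $\widetilde{\mathbf C}_{\mathcal{A}}^{n,n-k}(s)=\widetilde{\mathbf C}_{\mathcal{A}}^{n,n-k}(s;\boldsymbol\theta)=[\widetilde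 C_{\mathcal{A};ij}^{n,n-k}(s)]_{i=0,\ldots,K_n;\,j=0,\ldots,K_{n-k}}$ is the matrix of Laplace–Stieltjes transforms $$\widetilde C_{\mathcal{A};ij}^{n,n-k}(s)=\int_{0}^{\infty}e^{-sz}\,c^{n,n-k}_{\mathcal{A};i,j}(z)\,dz,$$ $$c^{n,n-k}_{\mathcal{A};i,j}(z)=\frac{\partial}{\partial z}\mathbb P\big(C_{\mathcal{A}}(\theta_{n-k})\le z,\ \varphi(\theta_{n-k})=j\mid X(0)=n,\varphi(0)=i\big),$$ where the density is understood in the generalized sense (the distribution may have an atom at $0$), i.e. $\widetilde C_{\mathcal{A};ij}^{n,n-k}(s)=\mathbb E\big[e^{-sC_{\mathcal{A}}(\theta_{n-k})}I(\theta_{n-k}<\infty,\varphi(\theta_{n-k})=j)\mid X(0)=n,\varphi(0)=i\big]$, computed for the process with generator $\mathbf Q(\boldsymbol\theta)$. For a matrix function $\mathbf A(\boldsymbol\theta)$ of $\boldsymbol\theta=(\vartheta_1,\ldots,\vartheta_p)$, $\frac{\partial\mathbf A(\boldsymbol\theta)}{\partial\boldsymbol\theta}=\left[\frac{\partial\mathbf A}{\partial\vartheta_1}\ \cdots\ \frac{\partial\mathbf A}{\partial\vartheta_p}\right]$ is the horizontal concatenation of the entrywise partial derivatives; $\mathbf I_p$ is the $p\times p$ identity matrix and $\otimes$ is the Kronecker product. *)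

(* Defs.v *)
From HB Require Import structures.
From mathcomp Require Import all_boot all_order all_algebra.
From mathcomp Require Import all_classical all_reals all_analysis.
From mathcomp Require Import complex mxtens.

Set Implicit Arguments.
Unset Strict Implicit.
Unset Printing Implicit Defensive.

Import Order.TTheory GRing.Theory Num.Theory.
Import numFieldNormedType.Exports.

Local Open Scope classical_set_scope.
Local Open Scope ring_scope.

(* A state is a pair (level, phase).  The process takes its values in the     *)
(* finite set [states N K]; pairs outside it are irrelevant.                  *)
Definition state : Type := (nat * nat)%type.

Definition states (N : nat) (K : nat -> nat) (x : state) : bool :=
  (x.1 <= N)%N && (x.2 <= K x.1)%N.

Section Generators.
Variables (R : realType) (N : nat) (K : nat -> nat).

Definition sum_space (f : state -> R) : R :=
  \sum_(n < N.+1) \sum_(i < (K n).+1) f (nat_of_ord n, nat_of_ord i).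

(* Generator of an LD-QBD process: nonnegative rates off the diagonal, zero   *)
(* row sums, and no transition between levels at distance more than one.      *)
Record ldqbd_generator (q : state -> state -> R) : Prop := {
  rate_ge0 : forall x y, states N K x -> states N K y -> x != y -> 0 <= q x y;
  rate_diag : forall x, states N K x ->
    q x x = - sum_space (fun y => if y == x then 0 else q x y);
  rate_level : forall x y, states N K x -> states N K y ->
    (x.1.+1 < y.1)%N || (y.1.+1 < x.1)%N -> q x y = 0 }.

(* [pt h x y] is the probability of moving from x to y in h units of time.    *)
Record transition_semigroup (q : state -> state -> R)
    (pt : R -> state -> state -> R) : Prop := {
  semigroup_ge0 : forall h x y, 0 <= h -> states N K x -> states N K y ->
    0 <= pt h x y;
  semigroup_sum1 : forall h x, 0 <= h -> states N K x ->
    sum_space (pt h x) = 1;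
  semigroup_id : forall x y, states N K x -> states N K y ->
    pt 0 x y = (x == y)%:R;
  semigroup_add : forall g h x y, 0 <= g -> 0 <= h ->
    states N K x -> states N K y ->
    pt (g + h) x y = sum_space (fun z => pt g x z * pt h z y);
  semigroup_generator : forall x y, states N K x -> states N K y ->
    (pt h x y - (x == y)%:R) / h @[h --> 0^'+] --> q x y }.

(* Under P, the process Z is a time-homogeneous right-continuous Markov chain *)
(* with generator q, started in x0.  The Markov property                      *)
(*   P(Z_(t (r+1)) = x (r+1) | Z_(t 0) = x 0, ..., Z_(t r) = x r)             *)
(*     = pt (t (r+1) - t r) (x r) (x (r+1))                                   *)
(* is written in product form, so that no conditioning event need be charged. *)
Record markov_chain (d : measure_display) (T : measurableType d)
    (q : state -> state -> R) (P : probability T R) (Z : R -> T -> state)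
    (x0 : state) : Prop := {
  chain_measurable : forall t x, 0 <= t -> measurable [set w | Z t w = x];
  chain_space : forall t w, 0 <= t -> states N K (Z t w);
  chain_right_continuous : forall t w, 0 <= t ->
    \forall u \near t^'+, Z u w = Z t w;
  chain_start : P [set w | Z 0 w = x0] = 1%E;
  chain_markov : exists2 pt, transition_semigroup q pt &
    forall (r : nat) (t : nat -> R) (x : nat -> state),
      0 <= t 0 -> nondecreasing_seq t -> (forall l, states N K (x l)) ->
      P [set w | forall l, (l <= r.+1)%N -> Z (t l) w = x l] =
      (P [set w | forall l, (l <= r)%N -> Z (t l) w = x l] *
        (pt (t r.+1 - t r) (x r) (x r.+1))%:E)%E }.

End Generators.

Section Costs.
Variables (R : realType) (d : measure_display) (T : measurableType d).
Variables (Z : R -> T -> state).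

Definition cost (c : state -> R) (A : {pred nat}) (t : R) (w : T) : R :=
  \int[lebesgue_measure]_(u in `[0, t]) (c (Z u w) * ((Z u w).1 \in A)%:R).

(* inf {t > 0 : X(t) = m}, equal to +oo when level m is never reached. *)
Definition hitting_time (m : nat) (w : T) : \bar R :=
  ereal_inf [set t%:E | t in [set t : R | 0 < t /\ (Z t w).1 = m]].

Definition cexp (z : R[i]) : R[i] :=
  Complex (expR (complex.Re z) * cos (complex.Im z))
          (expR (complex.Re z) * sin (complex.Im z)).

Definition cexpectation (P : probability T R) (f : T -> R[i]) : R[i] :=
  Complex (fine 'E_P[fun w => complex.Re (f w)])
          (fine 'E_P[fun w => complex.Im (f w)]).

(* The matrix of Laplace-Stieltjes transforms of the cost accumulated in A    *)
(* from a start in level n until level m is first reached:                    *)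
(*   E[exp(-s C_A(theta_m)) I(theta_m < oo, phi(theta_m) = j) | (n, i)],      *)
(* the conditioning being on the initial state, through the family P.         *)
Definition cost_lst (K : nat -> nat) (P : state -> probability T R)
    (c : state -> R) (A : {pred nat}) (s : R[i]) (n m : nat) :
    'M[R[i]]_((K n).+1, (K m).+1) :=
  \matrix_(i, j) cexpectation (P (n, nat_of_ord i)) (fun w =>
    let theta := hitting_time m w in
    if (theta < +oo)%E && ((Z (fine theta) w).2 == j :> nat)
    then cexp (- s * real_complex R (cost c A (fine theta) w)) else 0).

End Costs.

Section Blocks.
Variables (R : realType) (K : nat -> nat).

Definition rate_block (q : state -> state -> R) (n n' : nat) :
    'M[R]_((K n).+1, (K n').+1) :=
  \matrix_(i, j) q (n, nat_of_ord i) (n', nat_of_ord j).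

Definition complex_rate_block (q : state -> state -> R) (n n' : nat) :
    'M[R[i]]_((K n).+1, (K n').+1) :=
  map_mx (real_complex R) (rate_block q n n').

Definition cost_mx (c : state -> R) (n : nat) : 'M[R[i]]_((K n).+1) :=
  diag_mx (\row_i real_complex R (c (n, nat_of_ord i))).

End Blocks.

Section Jacobian.
Variables (R : realType) (p a b : nat).
Implicit Types (F : 'rV[R]_p -> 'M[R[i]]_(a, b)) (th : 'rV[R]_p).

(* Complex-valued functions of the real parameters are differentiated through *)
(* their real and imaginary parts.                                            *)
Definition has_partials F th : Prop := forall (l : 'I_p) i j,
  derivable (fun u => complex.Re (F u i j) : R) th (delta_mx 0 l) /\
  derivable (fun u => complex.Im (F u i j) : R) th (delta_mx 0 l).

Definition partial_mx F th (l : 'I_p) : 'M[R[i]]_(a, b) := \matrix_(i, j)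
  Complex ('D_(delta_mx 0 l) (fun u => complex.Re (F u i j) : R) th)
          ('D_(delta_mx 0 l) (fun u => complex.Im (F u i j) : R) th).

(* The horizontal concatenation [dF/dth_1 ... dF/dth_p]: the index l * b + j  *)
(* of a column stands for column j of the l-th partial derivative.            *)
Definition gradient_mx F th : 'M[R[i]]_(a, p * b) := \matrix_(i, lj)
  partial_mx F th (mxtens_unindex lj).1 i (mxtens_unindex lj).2.

End Jacobian.

(* Main.v *)
(** By the Markov property, the chain sampled on the grid of step h satisfies a
    one-step equation for the discounted weight of the first grid visit to
    level m.  By right-continuity of the paths the discounted weights converge
    to exp(-s C_A(theta_m)) as h -> 0, so dividing the one-step equation by h
    gives the backward equation
      sum_y q(x, y) F(y) = s c(x) I(x in A) F(x)
    off level m.  Eliminating the levels of this block tridiagonal system from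
    the top, with invertible pivots M_l, gives both M_m C^{m,m-1} = - Q^{m,m-1}
    and the factorization C^{n,m} = C^{n,n-1} C^{n-1,m}; neither the strong
    Markov property nor the jump chain is needed.  The pivots stay invertible
    near the given parameter, where these identities can be differentiated. *)
Require Import Defs.
From mathcomp Require Import all_boot all_order all_algebra.
From mathcomp Require Import all_classical all_reals all_analysis.
From mathcomp Require Import measurable_realfun.
From mathcomp Require Import complex mxtens ring lra zify.

Set Implicit Arguments.
Unset Strict Implicit.
Unset Printing Implicit Defensive.

Import Order.TTheory GRing.Theory Num.Theory.
Import numFieldNormedType.Exports.

Local Open Scope classical_set_scope.
Local Open Scope complex_scope.
Local Open Scope ring_scope.

(** * Transition semigroups *)

(** The Markov property supplies a transition semigroup separately for each initial state, whereas a
    one-step equation relates several initial states at once. The semigroups are therefore first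
    identified with each other, through their common generator. Grid times start at h rather than 0,
    matching the strict inequality in the definition of the hitting time. Two limits are taken in
    succession: at fixed h the horizon tends to infinity, because only finite-horizon weights can be
    evaluated from finite-dimensional distributions; then h = 1/(r+1) tends to 0. Measurability of
    the discounted weights and differentiability of the transforms both have to be established. The
    first passes through pointwise limits, starting from finite sums of indicators. The second
    follows from [C = - M^-1 Q], by descent from the top level, where the pivot at a level depends
    only on the transform one level higher. Since only the pivots above level n - k are inverted,
    the elimination lemmas carry a lower bound [b] on the levels. *)

Definition space_seq (N : nat) (K : nat -> nat) : seq state :=
  [seq (n, i) | n <- iota 0 N.+1, i <- iota 0 (K n).+1].

Lemma big_space_seq (V : nmodType) N K (f : state -> V) :
  \sum_(x <- space_seq N K) f x =
  \sum_(0 <= n < N.+1) \sum_(i < (K n).+1) f (n, nat_of_ord i).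
Proof.
rewrite /space_seq big_allpairs_dep /= /index_iota subn0; apply: eq_bigr => n _.
by rewrite -(big_mkord xpredT (fun i => f (n, i))) /index_iota subn0.
Qed.

Lemma cvg_sum_seq (R : realType) (I : eqType) (s : seq I) (u : I -> nat -> R)
    (l : I -> R) : (forall i, i \in s -> u i r @[r --> \oo] --> l i) ->
  \sum_(i <- s) u i r @[r --> \oo] --> \sum_(i <- s) l i.
Proof.
elim: s => [|i s IH] H.
  by under eq_cvg do rewrite big_nil; rewrite big_nil; exact: cvg_cst.
under eq_cvg do rewrite big_cons; rewrite big_cons.
apply: cvgD; first by apply: H; rewrite mem_head.
by apply: IH => k ks; apply: H; rewrite inE ks orbT.
Qed.

Section StateSpace.
Variables (R : realType) (N : nat) (K : nat -> nat).
Local Notation E := (space_seq N K).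

Lemma mem_space_seq x : (x \in E) = states N K x.
Proof.
rewrite /states; case: x => n i; apply/allpairsPdep/andP.
  move=> [n' [i' []]]; rewrite !mem_iota !add0n !ltnS => hn hi [-> ->].
  by split.
by move=> [hn hi]; exists n, i; rewrite !mem_iota !add0n !ltnS.
Qed.

Lemma space_seq_uniq : uniq E.
Proof.
apply: allpairs_uniq_dep => [|n _|]; rewrite ?iota_uniq //.
by move=> [n i] [n' i'] _ _ /= [-> ->].
Qed.

Lemma sum_spaceE (f : state -> R) : sum_space N K f = \sum_(x <- E) f x.
Proof. by rewrite big_space_seq big_mkord. Qed.

Lemma sum_delta (V : pzSemiRingType) (s : seq state) x (f : state -> V) :
  uniq s -> x \in s -> \sum_(y <- s) (x == y)%:R * f y = f x.
Proof.
move=> us xs; rewrite (bigD1_seq x) //= eqxx mul1r big1 ?addr0 // => y.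
by rewrite eq_sym => /negPf ->; rewrite mul0r.
Qed.

Lemma semigroup_generator_harmonic (q : state -> state -> R) pt t x y :
  transition_semigroup N K q pt -> 0 < t -> x \in E -> y \in E ->
  (pt (t * harmonic r) x y - (x == y)%:R) / (t * harmonic r) @[r --> \oo]
    --> q x y.
Proof.
move=> sg t0 xE yE; rewrite !mem_space_seq in xE yE.
have /cvg_at_rightP := semigroup_generator sg xE yE.
apply; split => [r|]; first by rewrite mulr_gt0 // invr_gt0.
by rewrite -[X in _ --> X](mulr0 t); apply: cvgM; [exact: cvg_cst|exact: cvg_harmonic].
Qed.

Lemma semigroup_row_sum (q : state -> state -> R) pt h x :
  transition_semigroup N K q pt -> 0 <= h -> x \in E ->
  \sum_(y <- E) pt h x y = 1.
Proof.
by move=> sg h0 xE; rewrite -sum_spaceE (semigroup_sum1 sg) // -mem_space_seq.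
Qed.

Lemma semigroup_comp (q : state -> state -> R) pt g h x y :
  transition_semigroup N K q pt -> 0 <= g -> 0 <= h -> x \in E -> y \in E ->
  pt (g + h) x y = \sum_(z <- E) pt g x z * pt h z y.
Proof.
move=> sg g0 h0 xE yE; rewrite -sum_spaceE (semigroup_add sg) //;
by rewrite -mem_space_seq.
Qed.

Section Uniqueness.
Variables (q : state -> state -> R) (p p' : R -> state -> state -> R).
Hypotheses (sg : transition_semigroup N K q p)
           (sg' : transition_semigroup N K q p').

Let dist (h : R) : R := \sum_(x <- E) \sum_(y <- E) `|p h x y - p' h x y|.

(** One more step costs at most [dist h]: the old error is carried through a kernel with row sums 1,
    and the new one is weighted by probabilities at most 1, hence bounded by its sum over all
    states. *)
Lemma semigroup_dist_muln h r x : 0 <= h -> x \in E ->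
  \sum_(y <- E) `|p (h *+ r) x y - p' (h *+ r) x y| <= dist h *+ r.
Proof.
move=> h0 xE; elim: r => [|r IH].
  rewrite !mulr0n big_seq big1 // => y yE.
  rewrite (semigroup_id sg) ?(semigroup_id sg') -?mem_space_seq //.
  by rewrite subrr normr0.
have hr0 : 0 <= h *+ r by rewrite mulrn_wge0.
rewrite !mulrSr.
apply: (@le_trans _ _ (\sum_(y <- E) ((\sum_(z <- E)
    `|p (h *+ r) x z - p' (h *+ r) x z| * p' h z y) +
    \sum_(z <- E) p (h *+ r) x z * `|p h z y - p' h z y|))).
  rewrite !(big_seq_cond xpredT); apply: ler_sum => y; rewrite andbT => yE.
  rewrite (semigroup_comp sg) // (semigroup_comp sg') //.
  rewrite -sumrB -big_split /=; apply: le_trans (ler_norm_sum _ _ _) _.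
  rewrite !(big_seq_cond xpredT); apply: ler_sum => z; rewrite andbT => zE.
  have -> : p (h *+ r) x z * p h z y - p' (h *+ r) x z * p' h z y =
    (p (h *+ r) x z - p' (h *+ r) x z) * p' h z y +
    p (h *+ r) x z * (p h z y - p' h z y).
    by ring.
  apply: le_trans (ler_normD _ _) _; rewrite !normrM.
  rewrite (ger0_norm (semigroup_ge0 sg' _ _ _)) -?mem_space_seq //.
  by rewrite (ger0_norm (semigroup_ge0 sg _ _ _)) -?mem_space_seq.
rewrite big_split /= lerD //.
  apply: le_trans IH; rewrite exchange_big /= le_eqVlt; apply/orP; left.
  apply/eqP; rewrite !(big_seq_cond xpredT); apply: eq_bigr => z.
  by rewrite andbT => zE; rewrite -mulr_sumr (semigroup_row_sum sg') // mulr1.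
rewrite exchange_big /= /dist !(big_seq_cond xpredT); apply: ler_sum => z.
rewrite andbT => zE; rewrite -mulr_sumr ler_piMl ?sumr_ge0 //.
rewrite -(semigroup_row_sum sg hr0 xE) (bigD1_seq z) ?space_seq_uniq //=.
rewrite lerDl big_seq_cond sumr_ge0 // => z' /andP[zE' _].
by rewrite (semigroup_ge0 sg) // -mem_space_seq.
Qed.

(* Telescoping [p (t / r) ^ r - p' (t / r) ^ r] costs [r * o(t / r)]. *)
Lemma semigroup_unique (t : R) x y : 0 <= t -> x \in E -> y \in E ->
  p t x y = p' t x y.
Proof.
move=> t0 xE yE; have [<-|tN0] := eqVneq 0 t.
  by rewrite (semigroup_id sg) ?(semigroup_id sg') -?mem_space_seq.
have {tN0} t0' : 0 < t by rewrite lt_def eq_sym tN0.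
apply/eqP; rewrite -subr_eq0 -normr_le0.
suff cv0 : t * (dist (t * harmonic r) / (t * harmonic r)) @[r --> \oo] --> (0 : R).
  apply: (cvgr_to_ge cv0); near=> r.
  have hr : 0 < t * harmonic r by rewrite mulr_gt0 // invr_gt0.
  have htr : (t * harmonic r) *+ r.+1 = t.
    by rewrite -mulr_natr mulrAC -mulrA mulfV ?mulr1 // pnatr_eq0.
  have := semigroup_dist_muln r.+1 (ltW hr) xE; rewrite htr => H.
  have -> : t * (dist (t * harmonic r) / (t * harmonic r)) =
    dist (t * harmonic r) *+ r.+1.
    rewrite -{1}htr mulrnAl mulrCA divff ?gt_eqF // mulr1 //.
  apply: le_trans H; rewrite (bigD1_seq y) ?space_seq_uniq //=.
  by rewrite lerDl sumr_ge0.
rewrite -[X in _ --> X](mulr0 t); apply: cvgM; first exact: cvg_cst.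
rewrite [X in _ --> X](_ : _ = \sum_(x' <- E) \sum_(y' <- E) (0 : R)); last first.
  by rewrite big1 // => ? _; rewrite big1.
rewrite (_ : (fun r : nat => _) = (fun r : nat => \sum_(x' <- E) \sum_(y' <- E)
    `|p (t * harmonic r) x' y' - p' (t * harmonic r) x' y'| /
      (t * harmonic r))); last first.
  apply/funext => r; rewrite /dist mulr_suml; apply: eq_bigr => x' _.
  by rewrite mulr_suml.
apply: cvg_sum_seq => x' xE'; apply: cvg_sum_seq => y' yE'.
have H := semigroup_generator_harmonic sg t0' xE' yE'.
have H' := semigroup_generator_harmonic sg' t0' xE' yE'.
(* Both difference quotients tend to [q x' y'], and the Kronecker deltas cancel in their
   difference. *)
have : `|(p (t * harmonic r) x' y' - (x' == y')%:R) / (t * harmonic r) -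
    (p' (t * harmonic r) x' y' - (x' == y')%:R) / (t * harmonic r)|
    @[r --> \oo] --> `|q x' y' - q x' y'|.
  by apply: cvg_norm; exact: cvgB.
rewrite subrr normr0.
apply: cvg_trans; apply: near_eq_cvg; apply: nearW => r /=.
have hr : 0 < (t * harmonic r)^-1 by rewrite invr_gt0 mulr_gt0 // invr_gt0.
by rewrite -mulrBl opprB addrA subrK normrM (gtr0_norm hr).
Unshelve. all: by end_near.
Qed.
End Uniqueness.

End StateSpace.

(** * Complex sequences and the exponential *)

Section ComplexSequences.
Variable R : realType.
Implicit Types (u v : nat -> R[i]) (a z l : R[i]).

(** Convergence by components fits [cexpectation], which is itself defined through real and
    imaginary parts. *)
Definition ccvg u l : Prop :=
  complex.Re (u r) @[r --> \oo] --> complex.Re l /\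
  complex.Im (u r) @[r --> \oo] --> complex.Im l.

Lemma cReM (x y : R[i]) : complex.Re (x * y) =
  complex.Re x * complex.Re y - complex.Im x * complex.Im y.
Proof. by case: x y => [? ?] [? ?]. Qed.

Lemma cImM (x y : R[i]) : complex.Im (x * y) =
  complex.Re x * complex.Im y + complex.Im x * complex.Re y.
Proof. by case: x y => [? ?] [? ?]. Qed.

Lemma cReD (x y : R[i]) : complex.Re (x + y) = complex.Re x + complex.Re y.
Proof. by case: x y => [? ?] [? ?]. Qed.

Lemma cImD (x y : R[i]) : complex.Im (x + y) = complex.Im x + complex.Im y.
Proof. by case: x y => [? ?] [? ?]. Qed.

Lemma complex_ext (x y : R[i]) :
  complex.Re x = complex.Re y -> complex.Im x = complex.Im y -> x = y.
Proof. by case: x y => [? ?] [? ?] /= -> ->. Qed.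

Lemma ccvg_cst l : ccvg (fun=> l) l.
Proof. by split; exact: cvg_cst. Qed.

Lemma ccvgD u v l z : ccvg u l -> ccvg v z -> ccvg (fun r => u r + v r) (l + z).
Proof.
move=> [ul1 ul2] [vz1 vz2]; split.
  by under eq_cvg do rewrite cReD; rewrite cReD; exact: cvgD.
by under eq_cvg do rewrite cImD; rewrite cImD; exact: cvgD.
Qed.

Lemma ccvgM u v l z : ccvg u l -> ccvg v z -> ccvg (fun r => u r * v r) (l * z).
Proof.
move=> [ul1 ul2] [vz1 vz2]; split.
  by under eq_cvg do rewrite cReM; rewrite cReM; apply: cvgB; exact: cvgM.
by under eq_cvg do rewrite cImM; rewrite cImM; apply: cvgD; exact: cvgM.
Qed.

Lemma ccvg_real (f : nat -> R) (x : R) :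
  f r @[r --> \oo] --> x -> ccvg (fun r => (f r)%:C) x%:C.
Proof. by move=> fx; split => //=; exact: cvg_cst. Qed.

Lemma ccvg_sum (I : eqType) (s : seq I) (u : I -> nat -> R[i]) (l : I -> R[i]) :
  (forall i, i \in s -> ccvg (u i) (l i)) ->
  ccvg (fun r => \sum_(i <- s) u i r) (\sum_(i <- s) l i).
Proof.
elim: s => [|i s IH] H.
  rewrite big_nil; under [X in ccvg X]eq_fun do rewrite big_nil.
  exact: ccvg_cst.
rewrite big_cons; under [X in ccvg X]eq_fun do rewrite big_cons.
apply: ccvgD; first by apply: H; rewrite mem_head.
by apply: IH => k ks; apply: H; rewrite inE ks orbT.
Qed.

Lemma ccvg_near u v l : (\forall r \near \oo, u r = v r) ->
  ccvg u l -> ccvg v l.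
Proof.
move=> uv [u1 u2]; split; [apply: cvg_trans u1|apply: cvg_trans u2];
  by apply: near_eq_cvg; apply: filterS uv => r ->.
Qed.

Lemma ccvg_unique u l z : ccvg u l -> ccvg u z -> l = z.
Proof.
move=> [u1 u2] [v1 v2]; apply: complex_ext.
- exact: (cvg_unique _ u1 v1).
- exact: (cvg_unique _ u2 v2).
Qed.

Lemma ccvg_shift u l : ccvg u l -> ccvg (fun r => u r.+1) l.
Proof.
by move=> [u1 u2]; split; [move: u1|move: u2]; rewrite -cvg_shiftS.
Qed.

Lemma cexpD a z : cexp (a + z) = cexp a * cexp z.
Proof.
case: a z => [a b] [c d]; apply: complex_ext;
  rewrite ?cReM ?cImM /= expRD ?cosD ?sinD; ring.
Qed.

Lemma cexp0 : cexp 0 = 1 :> R[i].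
Proof. by rewrite /cexp /= expR0 cos0 sin0 mulr1 mulr0. Qed.

Lemma ccvg_cexp u l : ccvg u l -> ccvg (fun r => cexp (u r)) (cexp l).
Proof.
move=> [u1 u2]; split => /=; apply: cvgM.
- by apply: continuous_cvg u1; exact: continuous_expR.
- by apply: continuous_cvg u2; exact: continuous_cos.
- by apply: continuous_cvg u1; exact: continuous_expR.
- by apply: continuous_cvg u2; exact: continuous_sin.
Qed.

Lemma cexp_le1 a : complex.Re a <= 0 ->
  `|complex.Re (cexp a)| <= 1 /\ `|complex.Im (cexp a)| <= 1.
Proof.
move=> a0; have e1 : `|expR (complex.Re a)| <= 1.
  by rewrite ger0_norm ?expR_ge0 // -expR0 ler_expR.
rewrite /= !normrM; split; apply: mulr_ile1 => //.
- by rewrite ler_norml cos_geN1 cos_le1.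
- by rewrite ler_norml sin_geN1 sin_le1.
Qed.

(** With [a] equal to [- s] times the cost rate, this limit produces the right-hand side of the
    backward equation. *)
Lemma cexp_derivative a :
  ccvg (fun r => (cexp (a * (harmonic r)%:C) - 1) * ((harmonic r)^-1)%:C) a.
Proof.
have cv (f : R -> R) (l : R) : is_derive (0 : R) 1 f l ->
    (f (harmonic r) - f 0) / harmonic r @[r --> \oo] --> l.
  move=> [df fl]; have : h^-1 *: ((f \o shift 0) (h *: 1) - f 0) @[h --> 0^'] --> l.
    by rewrite -fl; exact: df.
  move=> /cvgr_dnbhsP /(_ (@harmonic R)) H.
  have := H (conj (fun r => _) cvg_harmonic) => {}H.
  under eq_cvg => r.
    rewrite mulrC (_ : f (harmonic r) = (f \o shift 0) (harmonic r *: 1)).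
      over.
    by rewrite /= addr0 /GRing.scale /= mulr1.
  by apply: H => r; rewrite gt_eqF // invr_gt0.
have cvR : is_derive (0 : R) 1 (fun h => expR (complex.Re a * h) *
    cos (complex.Im a * h)) (complex.Re a).
  apply: is_derive_eq; rewrite /GRing.scale /=.
  rewrite !mulr0 expR0 sin0 cos0; ring.
have cvI : is_derive (0 : R) 1 (fun h => expR (complex.Re a * h) *
    sin (complex.Im a * h)) (complex.Im a).
  apply: is_derive_eq; rewrite /GRing.scale /=.
  rewrite !mulr0 expR0 sin0 cos0; ring.
split.
  have := cv _ _ cvR; apply: cvg_trans; apply: near_eq_cvg; apply: nearW => r.
  rewrite cReM cReD /= cReM cImM /= !(mulr0, subr0, add0r, expR0, cos0, mulr1).
  by [].
have := cv _ _ cvI; apply: cvg_trans; apply: near_eq_cvg; apply: nearW => r.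
rewrite cImM cImD /= cReM cImM /= !(mulr0, subr0, add0r, sin0, oppr0, addr0) /=.
by [].
Qed.
End ComplexSequences.

(** * Expectation of bounded complex random variables *)

Section ComplexExpectation.
Variables (R : realType) (d : measure_display) (T : measurableType d).
Implicit Types (P : probability T R) (F G : T -> R[i]) (f g : T -> R).

Definition bounded_measurable f : Prop :=
  measurable_fun setT f /\ exists M : R, forall w, `|f w| <= M.

Definition cbounded_measurable F : Prop :=
  bounded_measurable (fun w => complex.Re (F w)) /\
  bounded_measurable (fun w => complex.Im (F w)).

Lemma bounded_measurable_cst (x : R) : bounded_measurable (fun=> x).
Proof. by split; [exact: measurable_cst|exists `|x|]. Qed.

Lemma bounded_measurableD f g : bounded_measurable f -> bounded_measurable g ->
  bounded_measurable (fun w => f w + g w).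
Proof.
move=> [mf [M fM]] [mg [M' gM]]; split; first exact: measurable_funD.
by exists (M + M') => w; apply: le_trans (ler_normD _ _) _; rewrite lerD.
Qed.

Lemma bounded_measurableM f g : bounded_measurable f -> bounded_measurable g ->
  bounded_measurable (fun w => f w * g w).
Proof.
move=> [mf [M fM]] [mg [M' gM]]; split; first exact: measurable_funM.
by exists (M * M') => w; rewrite normrM ler_pM.
Qed.

Lemma bounded_measurableB f g : bounded_measurable f -> bounded_measurable g ->
  bounded_measurable (fun w => f w - g w).
Proof.
move=> bf bg; rewrite (_ : (fun w => _) = (fun w => f w + (-1) * g w)).
  apply: bounded_measurableD => //; apply: bounded_measurableM => //.
  exact: bounded_measurable_cst.
by apply/funext => w; rewrite mulN1r.
Qed.

Lemma bounded_measurable_integrable P f : bounded_measurable f ->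
  P.-integrable setT (EFin \o f).
Proof.
move=> [mf [M fM]]; apply: (@measurable_bounded_integrable _ _ _ P) => //.
  by rewrite (le_lt_trans (probability_le1 _ _)) ?ltry.
exists `|M|; split; first exact: num_real.
move=> x Mx w _ /=; apply: le_trans (fM w) _.
by apply: le_trans (ler_norm _) (ltW Mx).
Qed.

Lemma cbounded_measurable_cst (z : R[i]) : cbounded_measurable (fun=> z).
Proof. by split; exact: bounded_measurable_cst. Qed.

Lemma cbounded_measurableD F G : cbounded_measurable F ->
  cbounded_measurable G -> cbounded_measurable (fun w => F w + G w).
Proof.
move=> [F1 F2] [G1 G2]; split.
  by under eq_fun do rewrite cReD; exact: bounded_measurableD.
by under eq_fun do rewrite cImD; exact: bounded_measurableD.
Qed.

Lemma cbounded_measurableM F G : cbounded_measurable F ->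
  cbounded_measurable G -> cbounded_measurable (fun w => F w * G w).
Proof.
move=> [F1 F2] [G1 G2]; split.
  under eq_fun do rewrite cReM; apply: bounded_measurableB;
    exact: bounded_measurableM.
under eq_fun do rewrite cImM; apply: bounded_measurableD;
  exact: bounded_measurableM.
Qed.

Lemma cbounded_measurable_sum (I : Type) (s : seq I) (F : I -> T -> R[i]) :
  (forall i, cbounded_measurable (F i)) ->
  cbounded_measurable (fun w => \sum_(i <- s) F i w).
Proof.
move=> H; elim: s => [|i s IH].
  under eq_fun do rewrite big_nil; exact: cbounded_measurable_cst.
by under eq_fun do rewrite big_cons; exact: cbounded_measurableD.
Qed.

Lemma cbounded_measurable_nat (b : T -> bool) : measurable [set w | b w] ->
  cbounded_measurable (fun w => (b w)%:R).
Proof.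
move=> mb; have bE : (fun w => (b w)%:R : R) = \1_[set w | b w].
  apply/funext => w; rewrite indicE; congr (nat_of_bool _)%:R.
  by apply/idP/idP; rewrite inE.
have bm : bounded_measurable (fun w => (b w)%:R).
  split; first by rewrite bE; exact: measurable_indic.
  by exists 1 => w; case: (b w); rewrite ?normr1 ?normr0.
split.
  by rewrite (_ : (fun w => _) = fun w => (b w)%:R) //; apply/funext => w; case: (b w).
rewrite (_ : (fun w => _) = fun w => 0); first exact: bounded_measurable_cst.
by apply/funext => w; case: (b w).
Qed.

Lemma fine_expectation P f : fine 'E_P[f] = (\int[P]_w f w)%R.
Proof. by rewrite unlock. Qed.

Lemma cexpectation_cst P (z : R[i]) : cexpectation P (fun=> z) = z.
Proof.
case: z => x y; rewrite /cexpectation /= !fine_expectation.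
by rewrite !Rintegral_cst //= probability_setT /= !mulr1.
Qed.

Lemma cexpectationD P F G : cbounded_measurable F -> cbounded_measurable G ->
  cexpectation P (fun w => F w + G w) = cexpectation P F + cexpectation P G.
Proof.
move=> [F1 F2] [G1 G2]; apply: complex_ext;
  rewrite ?cReD ?cImD /= !fine_expectation -RintegralD //;
  try exact: bounded_measurable_integrable.
- by apply: eq_Rintegral => w _; rewrite cReD.
- by apply: eq_Rintegral => w _; rewrite cImD.
Qed.

Lemma cexpectation_sum P (I : Type) (s : seq I) (F : I -> T -> R[i]) :
  (forall i, cbounded_measurable (F i)) ->
  cexpectation P (fun w => \sum_(i <- s) F i w) =
  \sum_(i <- s) cexpectation P (F i).
Proof.
move=> H; elim: s => [|i s IH].
  under eq_fun do rewrite big_nil.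
  by rewrite big_nil cexpectation_cst.
under eq_fun do rewrite big_cons.
by rewrite big_cons cexpectationD ?IH //; exact: cbounded_measurable_sum.
Qed.

Lemma cexpectationZ P z F : cbounded_measurable F ->
  cexpectation P (fun w => z * F w) = z * cexpectation P F.
Proof.
move=> [F1 F2].
have I1 := bounded_measurable_integrable P F1.
have I2 := bounded_measurable_integrable P F2.
have H (x : R) f : bounded_measurable f ->
    P.-integrable setT (EFin \o (fun w => x * f w)).
  move=> bf; apply: bounded_measurable_integrable.
  by apply: bounded_measurableM => //; exact: bounded_measurable_cst.
apply: complex_ext; rewrite ?cReM ?cImM /= !fine_expectation -!RintegralZl //.
  rewrite -RintegralB //; try exact: H.
  by apply: eq_Rintegral => w _; rewrite cReM.
rewrite -RintegralD //; try exact: H.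
by apply: eq_Rintegral => w _; rewrite cImM.
Qed.

Lemma cexpectation_nat P (b : T -> bool) : measurable [set w | b w] ->
  cexpectation P (fun w => (b w)%:R) = (fine (P [set w | b w]))%:C.
Proof.
move=> mb; apply: complex_ext => /=; rewrite !fine_expectation; last first.
  rewrite (_ : (fun w => _) = cst 0) ?Rintegral_cst ?mul0r //.
  by apply/funext => w; case: (b w).
rewrite /Rintegral -[in RHS](setIT [set w | b w]) -integral_indic //.
congr fine; apply: eq_integral => w _; congr EFin; rewrite indicE.
have -> : (w \in [set w | b w]) = b w by apply/idP/idP; rewrite inE.
by case: (b w).
Qed.

(** Bounded convergence. The measurability of the limit is part of the conclusion so that the
    infinite-horizon weights can in turn be used as a sequence when the grid is refined. *)
Lemma ccvg_cexpectation P (F : nat -> T -> R[i]) G :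
  (forall r, cbounded_measurable (F r)) ->
  (forall r w, `|complex.Re (F r w)| <= 1 /\ `|complex.Im (F r w)| <= 1) ->
  (forall w, ccvg (fun r => F r w) (G w)) ->
  cbounded_measurable G /\
  ccvg (fun r => cexpectation P (F r)) (cexpectation P G).
Proof.
move=> mF F1 FG.
have H (f : nat -> T -> R) g : (forall r, measurable_fun setT (f r)) ->
    (forall r w, `|f r w| <= 1) -> (forall w, f r w @[r --> \oo] --> g w) ->
    bounded_measurable g /\
    fine 'E_P[f r] @[r --> \oo] --> fine 'E_P[g].
  move=> mf f1 fg; have bg : bounded_measurable g.
    split.
      by apply: (@measurable_fun_cvg _ _ _ _ f) => // w _; exact: fg.
    exists 1 => w; apply: (cvgr_to_le (cvg_norm (fg w))); exact: nearW.
  split => //.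
  rewrite unlock; apply: fine_cvg.
  rewrite fineK; last first.
    by apply: integrable_fin_num => //; exact: bounded_measurable_integrable.
  have [] // := @dominated_convergence _ _ _ P setT measurableT
    (fun r w => (f r w)%:E) (fun w => (g w)%:E) (fun=> 1%E).
  - by move=> r; exact/measurable_EFinP.
  - by apply/measurable_EFinP; case: bg.
  - by apply: aeW => w _; apply: cvg_EFin; [exact: nearW|exact: fg].
  - exact: (bounded_measurable_integrable _ (bounded_measurable_cst 1)).
  - by apply: aeW => w r _; rewrite lee_fin.
have [] := H _ _ (fun r => (mF r).1.1) (fun r w => (F1 r w).1)
  (fun w => (FG w).1).
have [] := H _ _ (fun r => (mF r).2.1) (fun r w => (F1 r w).2)
  (fun w => (FG w).2).
by move=> b2 c2 b1 c1; split; split.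
Qed.
End ComplexExpectation.

(** * Weights of grid paths and Riemann sums *)

Section HitWeight.
Variables (R : realType) (g : state -> R) (m j : nat) (s : R[i]).
Implicit Types (z : nat -> state) (h : R) (L t : nat).

(** Discounted weight of the first visit to level [m] among the indices 1 to [L]. Index 0 counts
    neither as a visit nor as a cost, and the visiting point itself is not charged. The recursion on
    the shifted path is the one-step decomposition that the Markov property will average. *)
Fixpoint hit_weight h L z : R[i] :=
  if L is L'.+1 then
    if (z 1%N).1 == m then ((z 1%N).2 == j)%:R
    else cexp (- s * (h * g (z 1%N))%:C) * hit_weight h L' (fun l => z l.+1)
  else 0.

Definition weight_at h z t : R[i] :=
  cexp (- s * (\sum_(l < t) h * g (z l.+1))%:C) * ((z t.+1).2 == j)%:R.

Lemma hit_weight_avoid h L z : (forall l, (l < L)%N -> (z l.+1).1 != m) ->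
  hit_weight h L z = 0.
Proof.
elim: L z => [//|L IH] z H /=; rewrite (negPf (H 0%N _)) //.
by rewrite IH ?mulr0 // => l lL; exact: (H l.+1).
Qed.

Lemma hit_weight_first h L z t : (t < L)%N -> (z t.+1).1 = m ->
  (forall l, (l < t)%N -> (z l.+1).1 != m) ->
  hit_weight h L z = weight_at h z t.
Proof.
elim: t L z => [|t IH] [//|L] z; rewrite ltnS => tL zm H /=.
  by rewrite zm eqxx /weight_at big_ord0 mulr0 cexp0 mul1r.
rewrite (negPf (H 0%N _)) // (IH L) //; last by move=> l lt; exact: (H l.+1).
rewrite /weight_at big_ord_recl /= mulrA -cexpD -mulrDr -rmorphD /=.
by [].
Qed.

(** The weight with infinite horizon; a path that never meets level [m] gets 0, in agreement with
    the indicator of a finite hitting time. *)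
Definition hit_weight_lim h z : R[i] :=
  if pselect (exists t, (z t.+1).1 == m) is left e then weight_at h z (ex_minn e)
  else 0.

Lemma hit_weight_limE h z t : (z t.+1).1 = m ->
  (forall l, (l < t)%N -> (z l.+1).1 != m) ->
  hit_weight_lim h z = weight_at h z t.
Proof.
move=> zm H; rewrite /hit_weight_lim; case: pselect => [e|[]]; last first.
  by exists t; rewrite zm.
case: ex_minnP => t' zt' min; congr weight_at; apply/eqP; rewrite eqn_leq.
rewrite min ?zm //= leqNgt; apply/negP => lt; move: (H _ lt).
by rewrite zt'.
Qed.

Lemma hit_weight_lim_avoid h z : (forall l, (z l.+1).1 <> m) ->
  hit_weight_lim h z = 0.
Proof.
move=> H; rewrite /hit_weight_lim; case: pselect => // e.
by exfalso; case: (e) => t /eqP zt; case: (H t).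
Qed.

Lemma hit_weight_cvg h z :
  ccvg (fun L => hit_weight h L z) (hit_weight_lim h z).
Proof.
rewrite /hit_weight_lim; case: pselect => [e|ne].
  case: ex_minnP => t /eqP zt min.
  apply: ccvg_near (ccvg_cst _); near=> L; symmetry; apply: hit_weight_first => //.
    by near: L; exists t.+1.
  by move=> l lt; apply/negP => zl; have := min _ zl; rewrite leqNgt lt.
apply: ccvg_near (ccvg_cst _); apply: nearW => L; symmetry.
by apply: hit_weight_avoid => l _; apply/negP => zl; apply: ne; exists l.
Unshelve. all: by end_near. Qed.

Hypotheses (s_ge0 : 0 <= complex.Re s).

Lemma weight_at_le1 h z t : 0 <= h -> (forall l, 0 <= g (z l)) ->
  `|complex.Re (weight_at h z t)| <= 1 /\ `|complex.Im (weight_at h z t)| <= 1.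
Proof.
move=> h0 g0; rewrite /weight_at; case: eqP => _; last first.
  by rewrite mulr0 normr0.
rewrite mulr1; apply: cexp_le1; rewrite cReM /= mulr0 subr0.
have : 0 <= \sum_(l < t) h * g (z l.+1) by apply: sumr_ge0 => l _; apply: mulr_ge0.
by case: s s_ge0 => a b /= a0 ?; rewrite mulNr oppr_le0 mulr_ge0.
Qed.

Lemma hit_weight_le1 h L z : 0 <= h -> (forall l, 0 <= g (z l)) ->
  `|complex.Re (hit_weight h L z)| <= 1 /\ `|complex.Im (hit_weight h L z)| <= 1.
Proof.
move=> h0 g0.
have [/existsP[t0 t0m]|] := boolP [exists t : 'I_L, (z t.+1).1 == m]; last first.
  rewrite negb_exists => /forallP H; rewrite hit_weight_avoid ?normr0 //.
  by move=> l lL; exact: (H (Ordinal lL)).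
have e : exists t, (z t.+1).1 == m by exists t0.
have [t /eqP zt min] := ex_minnP e.
rewrite (hit_weight_first h (t := t)) //; first exact: weight_at_le1.
  by apply: leq_ltn_trans (ltn_ord t0); exact: min.
by move=> l lt; apply/negP => zl; have := min _ zl; rewrite leqNgt lt.
Qed.

Lemma hit_weight_lim_le1 h z : 0 <= h -> (forall l, 0 <= g (z l)) ->
  `|complex.Re (hit_weight_lim h z)| <= 1 /\
  `|complex.Im (hit_weight_lim h z)| <= 1.
Proof.
move=> h0 g0; rewrite /hit_weight_lim; case: pselect => [e|_].
  exact: weight_at_le1.
by rewrite normr0.
Qed.
End HitWeight.

(** * Right-endpoint sums of right-continuous functions *)

Section RiemannSums.
Variables (R : realType) (phi : R -> R) (B x : R).
Hypotheses (x_ge0 : 0 <= x) (phi_ge0 : forall u : R, 0 <= u -> 0 <= phi u)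
  (phi_le : forall u : R, 0 <= u -> phi u <= B)
  (phi_rc : forall u : R, 0 <= u -> \forall v \near u^'+, phi v = phi u).

(** Cells carry the value at their right endpoint, because the weights charge the grid indices from
    1 on and because [phi] is controlled only to the right of each point. *)
Definition step (h : R) (t : nat) (u : R) : R :=
  \sum_(l < t) phi (l.+1%:R * h) * \1_`[l%:R * h, l.+1%:R * h[ u.

Lemma stepE (h : R) t k (u : R) : 0 < h -> k%:R * h <= u < k.+1%:R * h ->
  step h t u = if (k < t)%N then phi (k.+1%:R * h) else 0.
Proof.
move=> h0 /andP[ku uk].
have E (l : nat) : (\1_`[l%:R * h, l.+1%:R * h[ u : R) = (l == k)%:R.
  rewrite indicE; congr (nat_of_bool _)%:R; rewrite mem_setE in_itv /=.
  apply/andP/eqP => [[lu ul]|->]; last by rewrite ku.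
  have := le_lt_trans lu uk; have := le_lt_trans ku ul.
  by rewrite !ltr_pM2r // !ltr_nat; lia.
rewrite /step; under eq_bigr do rewrite E.
case: ifPn => kt.
  rewrite (bigD1 (Ordinal kt)) //= eqxx mulr1 big1 ?addr0 // => l lk.
  case: eqP => [lk'|]; rewrite ?mulr0 //.
  by case/eqP: lk; apply: val_inj.
rewrite big1 // => l _; case: eqP => [lk|]; rewrite ?mulr0 //.
by move: kt; rewrite -lk ltn_ord.
Qed.

Lemma grid_floor (h u : R) : 0 < h -> 0 <= u ->
  exists k : nat, k%:R * h <= u < k.+1%:R * h.
Proof.
move=> h0 u0; exists (Num.truncn (u / h)).
rewrite -ler_pdivlMr // -ltr_pdivrMr //.
by apply: truncn_itv; rewrite divr_ge0 // ltW.
Qed.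

Lemma step_bound (h : R) t (u : R) : 0 < h -> 0 <= u -> `|step h t u| <= B.
Proof.
move=> h0 u0; have [k kP] := grid_floor h0 u0; rewrite (stepE _ h0 kP).
have kh : 0 <= k.+1%:R * h by rewrite mulr_ge0 // ltW.
case: ifP => _; first by rewrite ger0_norm ?phi_ge0 ?phi_le.
by rewrite normr0 (le_trans (phi_ge0 u0)) ?phi_le.
Qed.

Lemma measurable_step h t (D : set R) : measurable_fun D (step h t).
Proof. by apply: measurable_sum => l; exact: measurable_funM. Qed.

Lemma bounded_itv_integrable (f : R -> R) (M : R) :
  measurable_fun `[0, x[ f -> (forall u, 0 <= u -> `|f u| <= M) ->
  lebesgue_measure.-integrable `[0, x[ (EFin \o f).
Proof.
move=> mf fM; apply: measurable_bounded_integrable => //.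
  apply: (eq_ind_r (fun e => (e < +oo)%E) _ (lebesgue_measure_itv `[0, x[)).
  by case: ifP => _; rewrite ltry.
exists M; split; first exact: num_real.
move=> M' MM u /=; rewrite in_itv /= => /andP[u0 _].
by apply: le_trans (ltW MM); exact: fM.
Qed.

Lemma integral_step (h : R) t : 0 < h -> t%:R * h <= x ->
  \int[lebesgue_measure]_(u in `[0, x[) step h t u =
  \sum_(l < t) h * phi (l.+1%:R * h).
Proof.
move=> h0; elim: t => [|t IH] tx.
  rewrite big_ord0 (_ : step h 0 = cst 0) ?Rintegral_cst ?mul0r //.
  by apply/funext => u; rewrite /step big_ord0.
have tx' : t%:R * h <= x by apply: le_trans tx; rewrite ler_pM2r // ler_nat.
rewrite (_ : step h t.+1 = fun u => step h t u +
    phi (t.+1%:R * h) * \1_`[t%:R * h, t.+1%:R * h[ u); last first.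
  by apply/funext => u; rewrite /step big_ord_recr.
rewrite RintegralD //; first last.
- apply: (bounded_itv_integrable (M := `|phi (t.+1%:R * h)|)).
    by apply: measurable_funM => //; exact: measurable_indic.
  by move=> u _; rewrite normrM ler_piMr // indicE; case: (_ \in _);
    rewrite ?normr1 ?normr0.
- apply: (bounded_itv_integrable (M := B)) => [|u u0]; first exact: measurable_step.
  exact: step_bound.
rewrite IH // RintegralZl //; last first.
  apply: (bounded_itv_integrable (M := 1)); first exact: measurable_indic.
  by move=> u _; rewrite indicE; case: (_ \in _); rewrite ?normr1 ?normr0.
rewrite big_ord_recr /= mulrC; congr (_ + _ * _).
rewrite /Rintegral integral_indic // setIidl.
  rewrite [X in fine X](_ : _ = h%:E) //.
  apply: etrans; first exact: lebesgue_measure_itv.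
  rewrite /= lte_fin ltr_pM2r // ltr_nat ltnSn /=.
  by rewrite -EFinB -mulrBl -natrB // subSnn mul1r.
move=> u /=; rewrite !in_itv /= => /andP[tu ut].
rewrite (le_trans _ tu) ?mulr_ge0 ?(ltW h0) //=.
exact: lt_le_trans ut tx.
Qed.

Variable t : nat -> nat.
Hypothesis t_near : \forall r \near \oo,
  x - harmonic r <= (t r)%:R * harmonic r <= x.

(** The sequence is eventually constant: as soon as the mesh is shorter than the interval to the
    right of [u] on which [phi] keeps its value, the right endpoint of the cell of [u] lies in that
    interval. *)
Lemma step_cvg (u : R) : 0 <= u < x ->
  step (harmonic r) (t r) u @[r --> \oo] --> phi u.
Proof.
move=> /andP[u0 ux].
have [e /= e0 ephi] := phi_rc u0.
have h0 r : 0 < harmonic r :> R by rewrite invr_gt0.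
have cst : (fun=> phi u) r @[r --> \oo] --> phi u by exact: cvg_cst.
apply: cvg_trans cst; apply: near_eq_cvg; near=> r.
have [k kP] := grid_floor (h0 r) u0; have [/andP[ku uk]] := (kP, tt).
have ke : k.+1%:R * harmonic r <= u + harmonic r.
  by rewrite -natr1 mulrDl mul1r lerD2r.
(* The bound by [x - u] places the cell of [u] among the [t r] cells that are summed, since these
   reach at least to [x - harmonic r]. *)
have hr : harmonic r < Num.min e (x - u).
  near: r; apply: (cvgr_lt _ (@cvg_harmonic R)).
  by rewrite lt_min e0 subr_gt0.
move: hr; rewrite lt_min => /andP[he hx].
rewrite (stepE _ (h0 r) kP) ifT.
  have H : `|u - k.+1%:R * harmonic r| < e.
    by rewrite ltr_norml; apply/andP; split; lra.
  by symmetry; apply: ephi => //; exact: H.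
have : x - harmonic r <= (t r)%:R * harmonic r <= x by near: r.
move=> /andP[xt _]; rewrite -(ltr_nat R) -(ltr_pM2r (h0 r)).
lra.
Unshelve. all: by end_near. Qed.

(** The regularity in time is given pointwise, as right-continuity; it becomes measurability through
    the approximating step functions. *)
Lemma measurable_step_lim : measurable_fun `[0, x[ phi.
Proof.
apply: (@measurable_fun_cvg _ _ _ _ (fun r => step (harmonic r) (t r))).
  by move=> r; exact: measurable_step.
by move=> u /=; rewrite in_itv /=; exact: step_cvg.
Qed.

(** Dominated convergence of the step functions under the constant [B]; each sum is the exact
    integral of its step function, because the cells end before [x]. *)
Lemma riemann_sum_cvg :
  \sum_(l < t r) harmonic r * phi (l.+1%:R * harmonic r) @[r --> \oo] -->
  \int[lebesgue_measure]_(u in `[0, x]) phi u.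
Proof.
have h0 r : 0 < harmonic r :> R by rewrite invr_gt0.
have iphi : lebesgue_measure.-integrable `[0, x[ (EFin \o phi).
  apply: (bounded_itv_integrable (M := B)); first exact: measurable_step_lim.
  by move=> u u0; rewrite ger0_norm ?phi_ge0 ?phi_le.
rewrite -Rintegral_itv_bndo_bndc //.
suff : \int[lebesgue_measure]_(u in `[0, x[) step (harmonic r) (t r) u
    @[r --> \oo] --> \int[lebesgue_measure]_(u in `[0, x[) phi u.
  apply: cvg_trans; apply: near_eq_cvg; near=> r.
  have : x - harmonic r <= (t r)%:R * harmonic r <= x by near: r.
  by move=> /andP[_ tx]; rewrite integral_step.
apply: fine_cvg; rewrite fineK; last by apply: integrable_fin_num.
have [] // := @dominated_convergence _ _ _ (@lebesgue_measure R)
  `[0, x[%classic _ (fun r u => (step (harmonic r) (t r) u)%:E)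
  (fun u => (phi u)%:E) (fun=> B%:E).
- by move=> r; apply/measurable_EFinP; exact: measurable_step.
- by apply/measurable_EFinP; exact: measurable_step_lim.
- apply: aeW => u /=; rewrite in_itv /= => u0x.
  by apply: cvg_EFin; [exact: nearW|exact: step_cvg].
- apply: (bounded_itv_integrable (M := `|B|)) => //.
- by apply: aeW => u r /=; rewrite in_itv /= => /andP[u0 _]; rewrite lee_fin step_bound.
Unshelve. all: by end_near. Qed.
End RiemannSums.

(** * Hitting times observed on a grid *)

Section HittingTimes.
Variables (R : realType) (d : measure_display) (T : measurableType d).
Variables (N : nat) (K : nat -> nat) (Z : R -> T -> state) (w : T) (m : nat).
Hypothesis Z_rc : forall t, 0 <= t -> \forall u \near t^'+, Z u w = Z t w.

Lemma hitting_time_le (t : R) : 0 < t -> (Z t w).1 = m ->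
  (hitting_time Z m w <= t%:E)%E.
Proof. by move=> t0 tm; apply: ereal_inf_lbound; exists t. Qed.

Lemma hitting_time_ge0 : (0 <= hitting_time Z m w)%E.
Proof.
by apply: le_ereal_inf_tmp => _ [t [t0 _] <-]; rewrite lee_fin ltW.
Qed.

(** The infimum is attained: some visit to level [m] takes place before [x + e], and there the path
    still has its value at [x]. *)
Lemma hitting_timeP (x : R) : hitting_time Z m w = x%:E ->
  exists2 e : R, 0 < e &
    (Z x w).1 = m /\ forall v, x <= v < x + e -> Z v w = Z x w.
Proof.
move=> hx; have x0 : 0 <= x by rewrite -lee_fin -hx hitting_time_ge0.
have [e /= e0 eZ] := Z_rc x0.
have Zv v : x <= v < x + e -> Z v w = Z x w.
  rewrite le_eqVlt => /andP[/orP[/eqP<-//|xv] ve]; apply: eZ => //=.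
  by rewrite ltr_norml; apply/andP; split; lra.
exists e => //; split => //.
have : (hitting_time Z m w < (x + e)%:E)%E by rewrite hx lte_fin ltrDl.
rewrite /hitting_time => /ereal_inf_lt[_ [t [t0 tm] <-]].
rewrite lte_fin => te; rewrite -(Zv t) // te andbT.
by rewrite -lee_fin -hx hitting_time_le.
Qed.


(** No positive time before [x] is a visit, and the first positive grid time from [x] on is at most
    [x + h], inside the window where the path keeps its value. Hence the first grid visit sees the
    same phase as the true one, and its index exceeds by one the number [t] of charged points. *)
Lemma grid_hit (x e h : R) : hitting_time Z m w = x%:E ->
  (forall v, x <= v < x + e -> Z v w = Z x w) -> (Z x w).1 = m ->
  0 < h < e ->
  exists t : nat, [/\ x - h <= t%:R * h <= x, Z (t.+1%:R * h) w = Z x w &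
    forall l, (l < t)%N -> (Z (l.+1%:R * h) w).1 != m].
Proof.
move=> hx eZ xm /andP[h0 he].
have x0 : 0 <= x by rewrite -lee_fin -hx hitting_time_ge0.
have [k /andP[kx xk]] := grid_floor h0 x0.
have kS l : l.+1%:R * h = l%:R * h + h by rewrite -natr1 mulrDl mul1r.
have ex : exists t : nat, (Z (t.+1%:R * h) w).1 == m.
  by exists k; rewrite eZ ?xm // (ltW xk) kS /=; lra.
have [t /eqP tm min] := ex_minnP ex.
have tk : (t <= k)%N by apply: min; rewrite eZ ?xm // (ltW xk) kS /=; lra.
have tkh : t%:R * h <= k%:R * h by rewrite ler_pM2r // ler_nat.
have xt : x <= t.+1%:R * h.
  by rewrite -lee_fin -hx hitting_time_le // mulr_gt0.
exists t; split.
- by rewrite kS in xt; apply/andP; split; lra.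
- by apply: eZ; rewrite xt /= kS; lra.
- by move=> l lt; apply/negP => zl; have := min _ zl; rewrite leqNgt lt.
Qed.

Variables (c : state -> R) (A : {pred nat}) (j : nat) (s : R[i]).
Hypothesis c_ge0 : forall x, states N K x -> 0 <= c x.
Hypothesis Z_states : forall t, 0 <= t -> states N K (Z t w).
Let g (x : state) : R := c x * (x.1 \in A)%:R.

(** For a finite hitting time the phase on the grid is eventually the right one and the exponent is
    a Riemann sum of the cost; for an infinite one the weight vanishes on every grid. *)
Lemma hit_weight_path_cvg :
  ccvg (fun r => hit_weight_lim g m j s (harmonic r)
          (fun l => Z (l%:R * harmonic r) w))
    (let theta := hitting_time Z m w in
     if (theta < +oo)%E && ((Z (fine theta) w).2 == j)
     then cexp (- s * (cost Z c A (fine theta) w)%:C) else 0).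
Proof.
have h0 r : 0 < harmonic r :> R by rewrite invr_gt0.
have th0 := hitting_time_ge0; case hx : (hitting_time Z m w) => [x| |] /=.
- have x0 : 0 <= x by rewrite -lee_fin -hx.
  have [e e0 [xm eZ]] := hitting_timeP hx.
  (* For the finitely many meshes that are too coarse, the index is given the dummy value 0. *)
  have /choice[t tP] : forall r, exists t : nat, harmonic r < e ->
      [/\ x - harmonic r <= t%:R * harmonic r <= x,
        Z (t.+1%:R * harmonic r) w = Z x w &
        forall l, (l < t)%N -> (Z (l.+1%:R * harmonic r) w).1 != m].
    move=> r; have [he|he] := boolP (harmonic r < e); last by exists 0%N.
    by have [|t tP] := grid_hit hx eZ xm (h := harmonic r); [rewrite h0|exists t].
  have he : \forall r \near \oo, harmonic r < e.
    exact: (cvgr_lt _ (@cvg_harmonic R)).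
  rewrite ltry /=.
  pose rs r := \sum_(l < t r) harmonic r * g (Z (l.+1%:R * harmonic r) w).
  suff rs_cvg : rs r @[r --> \oo] --> cost Z c A x w.
    have : ccvg (fun r => cexp (- s * (rs r)%:C) * ((Z x w).2 == j)%:R)
        (cexp (- s * (cost Z c A x w)%:C) * ((Z x w).2 == j)%:R).
      apply: ccvgM (ccvg_cst _); apply: ccvg_cexp; apply: ccvgM (ccvg_cst _) _.
      exact: ccvg_real.
    rewrite (_ : cexp _ * _ = if (Z x w).2 == j
      then cexp (- s * (cost Z c A x w)%:C) else 0); last first.
      by case: eqP; rewrite ?mulr1 ?mulr0.
    apply: ccvg_near; near=> r.
    have [_ Zt tmin] : [/\ x - harmonic r <= (t r)%:R * harmonic r <= x,
        Z ((t r).+1%:R * harmonic r) w = Z x w &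
        forall l, (l < t r)%N -> (Z (l.+1%:R * harmonic r) w).1 != m].
      by apply: tP; near: r.
    by rewrite (hit_weight_limE _ _ _ _ (t := t r)) ?Zt // /weight_at Zt.
  (* The cost rates are nonnegative on the state space, so their sum over it bounds the rate along
     any path. *)
  rewrite /rs /cost; apply: (@riemann_sum_cvg R (fun u => g (Z u w))
    (\sum_(y <- space_seq N K) g y)) => //.
  + by move=> u u0; rewrite mulr_ge0 ?c_ge0 ?Z_states.
  + move=> u u0; have Zu : Z u w \in space_seq N K.
      by rewrite mem_space_seq Z_states.
    rewrite (bigD1_seq (Z u w)) ?space_seq_uniq //= lerDl big_seq_cond.
    apply: sumr_ge0 => y /andP[]; rewrite mem_space_seq => yN _.
    by rewrite mulr_ge0 ?c_ge0.
  + by move=> u u0; apply: filterS (Z_rc u0) => v ->.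
  + by apply: filterS he => r /tP[].
- apply: ccvg_near (ccvg_cst _); apply: nearW => r; symmetry.
  apply: hit_weight_lim_avoid => l lm; have := hitting_time_le _ lm.
  by rewrite hx mulr_gt0 // => /(_ isT).
- by move: th0; rewrite hx.
Unshelve. all: by end_near. Qed.
End HittingTimes.

(** * The chain sampled on a grid *)

Section DiscretizedChain.
Variables (R : realType) (N : nat) (K : nat -> nat).
Variables (q : state -> state -> R) (p : R -> state -> state -> R).
Variables (d : measure_display) (T : measurableType d).
Variables (P : state -> probability T R) (Z : R -> T -> state).
Hypothesis Z_chain : forall x, states N K x -> markov_chain N K q (P x) Z x.
Local Notation E := (space_seq N K).

(** The semigroups attached to the different initial states share the generator [q], so
    [semigroup_unique] lets the one obtained for state (0, 0) serve for all. *)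
Lemma chain_common_semigroup : exists2 pt, transition_semigroup N K q pt &
  forall x0 r (t : nat -> R) (x : nat -> state), states N K x0 ->
    0 <= t 0 -> nondecreasing_seq t -> (forall l, states N K (x l)) ->
    P x0 [set w | forall l, (l <= r.+1)%N -> Z (t l) w = x l] =
    (P x0 [set w | forall l, (l <= r)%N -> Z (t l) w = x l] *
      (pt (t r.+1 - t r) (x r) (x r.+1))%:E)%E.
Proof.
have st0 : states N K (0, 0)%N by [].
have [pt sg _] := chain_markov (Z_chain st0); exists pt => // x0 r t x sx0 t0 ndt xs.
have [pt' sg' ->] := chain_markov (Z_chain sx0) => //.
rewrite (semigroup_unique sg' sg) ?mem_space_seq // subr_ge0.
exact: ndt.
Qed.

Hypothesis p_markov : forall x0 r (t : nat -> R) (x : nat -> state),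
  states N K x0 -> 0 <= t 0 -> nondecreasing_seq t ->
  (forall l, states N K (x l)) ->
  P x0 [set w | forall l, (l <= r.+1)%N -> Z (t l) w = x l] =
  (P x0 [set w | forall l, (l <= r)%N -> Z (t l) w = x l] *
    (p (t r.+1 - t r) (x r) (x r.+1))%:E)%E.

Variables (c : state -> R) (A : {pred nat}) (m j : nat) (s : R[i]).
Hypothesis c_ge0 : forall x, states N K x -> 0 <= c x.
Hypothesis s_ge0 : 0 <= complex.Re s.
Let g (x : state) : R := c x * (x.1 \in A)%:R.

Lemma chain_states t w : 0 <= t -> states N K (Z t w).
Proof.
have st0 : states N K (0, 0)%N by [].
exact: (chain_space (Z_chain st0)).
Qed.

Lemma chain_event_measurable t x : 0 <= t -> measurable [set w | Z t w == x].
Proof.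
have st0 : states N K (0, 0)%N by [].
move=> t0; rewrite (_ : [set w | Z t w == x] = [set w | Z t w = x]).
  exact: (chain_measurable (Z_chain st0)).
by apply/seteqP; split => w /= /eqP.
Qed.

Section FixedStep.
Variable h : R.
Hypothesis h_ge0 : 0 <= h.

Let grid_ge0 r : 0 <= r%:R * h.
Proof. by rewrite mulr_ge0. Qed.

Definition grid_path (x : nat -> state) r w : bool :=
  all (fun l => Z (l%:R * h) w == x l) (iota 0 r.+1).

Lemma grid_pathS x r w :
  grid_path x r.+1 w = grid_path x r w && (Z (r.+1%:R * h) w == x r.+1).
Proof.
rewrite /grid_path -(addn1 r.+1) iotaD all_cat; congr (_ && _).
by rewrite /= andbT add0n.
Qed.

Lemma grid_pathP x r w :
  reflect (forall l, (l <= r)%N -> Z (l%:R * h) w = x l) (grid_path x r w).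
Proof.
apply: (iffP allP) => [H l lr|H l]; first by apply/eqP/H; rewrite mem_iota.
by rewrite mem_iota /= => lr; apply/eqP/H.
Qed.

Lemma eq_grid_path x y r w : (forall l, (l <= r)%N -> x l = y l) ->
  grid_path x r w = grid_path y r w.
Proof.
by move=> xy; apply/grid_pathP/grid_pathP => H l lr; rewrite H ?xy.
Qed.

Lemma grid_path_measurable x r : measurable [set w | grid_path x r w].
Proof.
elim: r => [|r IH].
  rewrite (_ : [set w | _] = [set w | Z (0%:R * h) w == x 0%N]).
    exact: chain_event_measurable.
  by apply/seteqP; split => w; rewrite /grid_path /= andbT.
rewrite (_ : [set w | _] = [set w | grid_path x r w] `&`
  [set w | Z (r.+1%:R * h) w == x r.+1]).
  by apply: measurableI => //; exact: chain_event_measurable.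
by apply/seteqP; split => w /=; rewrite grid_pathS => /andP.
Qed.

Lemma grid_path_prob x0 x r : states N K x0 -> (forall l, states N K (x l)) ->
  fine (P x0 [set w | grid_path x r.+1 w]) =
  fine (P x0 [set w | grid_path x r w]) * p h (x r) (x r.+1).
Proof.
move=> sx0 sx.
have pE k : [set w | grid_path x k w] =
    [set w | forall l, (l <= k)%N -> Z (l%:R * h) w = x l].
  by apply/seteqP; split => w /= /grid_pathP.
rewrite !pE (@p_markov x0 r (fun l => l%:R * h)) //; last first.
  by move=> k l kl; rewrite ler_wpM2r // ler_nat.
rewrite fineM //; last by rewrite -pE fin_num_measure //; exact: grid_path_measurable.
by rewrite /= -mulrBl -natrB // subSnn mul1r.
Qed.

Lemma hit_weight_split L r w :
  hit_weight g m j s h L.+1 (fun l => Z ((r + l)%:R * h) w) =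
  \sum_(y <- E) (Z (r.+1%:R * h) w == y)%:R *
    (if y.1 == m then (y.2 == j)%:R else cexp (- s * (h * g y)%:C) *
       hit_weight g m j s h L (fun l => Z ((r.+1 + l)%:R * h) w)).
Proof.
rewrite (sum_delta _ (space_seq_uniq N K)); last first.
  by rewrite mem_space_seq chain_states.
rewrite /= addn1; case: ifP => // _; congr (_ * hit_weight _ _ _ _ _ _ _).
by apply/funext => l; rewrite addnS.
Qed.

Lemma hit_weight_measurable L r : cbounded_measurable (fun w =>
  hit_weight g m j s h L (fun l => Z ((r + l)%:R * h) w)).
Proof.
elim: L r => [|L IH] r; first exact: cbounded_measurable_cst.
under eq_fun do rewrite hit_weight_split.
apply: cbounded_measurable_sum => y; apply: cbounded_measurableM.
  by apply: cbounded_measurable_nat; exact: chain_event_measurable.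
case: (y.1 == m); first exact: cbounded_measurable_cst.
by apply: cbounded_measurableM => //; exact: cbounded_measurable_cst.
Qed.

(** The expectation of [hit_weight] as dynamic programming on the one-step kernel; that it is this
    expectation is [mean_weightE]. *)
Fixpoint mean_weight L (x : state) : R[i] :=
  if L is L'.+1 then \sum_(y <- E) (p h x y)%:C *
    (if y.1 == m then (y.2 == j)%:R
     else cexp (- s * (h * g y)%:C) * mean_weight L' y)
  else 0.

(** The Markov property is available only for complete histories in product form. The induction on
    the horizon therefore keeps the whole past of the grid path as an indicator and lengthens it by
    one state at each step. *)
Lemma mean_weight_grid_path L r x0 x : states N K x0 ->
  (forall l, states N K (x l)) ->
  cexpectation (P x0) (fun w => (grid_path x r w)%:R *
    hit_weight g m j s h L (fun l => Z ((r + l)%:R * h) w)) =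
  (fine (P x0 [set w | grid_path x r w]))%:C * mean_weight L (x r).
Proof.
move=> sx0; elim: L r x => [|L IH] r x sx.
  by under eq_fun do rewrite mulr0; rewrite cexpectation_cst mulr0.
(* The past [x] up to index [r], followed by [y]; repeating [y] afterwards keeps the sequence in the
   state space. *)
pose xs y l := if (l <= r)%N then x l else y.
have pre y w : (grid_path x r w)%:R * (Z (r.+1%:R * h) w == y)%:R =
    (grid_path (xs y) r.+1 w)%:R :> R[i].
  rewrite grid_pathS {2}/xs ltnn (eq_grid_path (y := x)); last first.
    by move=> l lr; rewrite /xs lr.
  by case: grid_path; rewrite ?mul0r ?mul1r.
have pp y : states N K y -> fine (P x0 [set w | grid_path (xs y) r.+1 w]) =
    fine (P x0 [set w | grid_path x r w]) * p h (x r) y.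
  move=> sy; rewrite grid_path_prob //; last by move=> l; rewrite /xs; case: ifP.
  rewrite {2 3}/xs leqnn ltnn; congr (fine (P x0 _) * _).
  by apply/seteqP; split => w /=; rewrite (eq_grid_path (y := x)) // => l lr;
    rewrite /xs lr.
under eq_fun do rewrite hit_weight_split mulr_sumr.
have mp y : cbounded_measurable (fun w => (grid_path (xs y) r.+1 w)%:R).
  by apply: cbounded_measurable_nat; exact: grid_path_measurable.
have mW y : cbounded_measurable (fun w =>
    if y.1 == m then (y.2 == j)%:R else cexp (- s * (h * g y)%:C) *
       hit_weight g m j s h L (fun l => Z ((r.+1 + l)%:R * h) w)).
  case: (y.1 == m); first exact: cbounded_measurable_cst.
  apply: cbounded_measurableM; first exact: cbounded_measurable_cst.
  exact: hit_weight_measurable.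
rewrite cexpectation_sum; last first.
  move=> y; under eq_fun do rewrite mulrA pre.
  exact: cbounded_measurableM.
rewrite /= mulr_sumr !big_seq; apply: eq_bigr => y; rewrite mem_space_seq => sy.
under eq_fun do rewrite mulrA pre.
rewrite [RHS]mulrA -(rmorphM (real_complex R)) -pp //=; case: (y.1 == m).
  under eq_fun do rewrite mulrC.
  rewrite cexpectationZ // cexpectation_nat 1?mulrC //.
  exact: grid_path_measurable.
under eq_fun do rewrite mulrCA.
rewrite cexpectationZ; last first.
  by apply: cbounded_measurableM => //; exact: hit_weight_measurable.
rewrite IH; last by move=> l; rewrite /xs; case: ifP.
by rewrite {2}/xs ltnn mulrCA.
Qed.

Lemma mean_weightE L x : states N K x ->
  cexpectation (P x) (fun w =>
    hit_weight g m j s h L (fun l => Z (l%:R * h) w)) = mean_weight L x.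
Proof.
move=> sx.
have zE w : hit_weight g m j s h L (fun l => Z (l%:R * h) w) =
    \sum_(y <- E) (grid_path (fun=> y) 0 w)%:R *
      hit_weight g m j s h L (fun l => Z ((0 + l)%:R * h) w).
  rewrite -mulr_suml (_ : \sum_(y <- E) _ = 1) ?mul1r //.
  rewrite -[RHS](sum_delta (fun=> 1) (space_seq_uniq N K)
    (x := Z (0%:R * h) w)).
    by apply: eq_bigr => y _; rewrite /grid_path /= andbT mulr1.
  by rewrite mem_space_seq chain_states.
under eq_fun do rewrite zE.
rewrite cexpectation_sum => [|y]; last first.
  apply: cbounded_measurableM; last exact: hit_weight_measurable.
  by apply: cbounded_measurable_nat; exact: grid_path_measurable.
rewrite -[RHS](sum_delta (mean_weight L) (space_seq_uniq N K)) ?mem_space_seq //.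
rewrite !big_seq; apply: eq_bigr => y; rewrite mem_space_seq => sy.
rewrite mean_weight_grid_path //; congr (_ * _).
have start : P x [set w | Z 0 w = x] = 1%E := chain_start (Z_chain sx).
have mE z : measurable [set w | Z 0 w = z].
  exact: (chain_measurable (Z_chain sx)).
rewrite (_ : [set w | _] = [set w | Z 0 w = y]); last first.
  by apply/seteqP; split => w; rewrite /grid_path /= mul0r andbT => /eqP.
(* Under [P x] the chain starts almost surely in [x], so every other initial state contributes a
   null event. *)
case: eqP => [<-|xy]; first by rewrite start.
rewrite (_ : P x _ = 0%E) //; apply/eqP; rewrite eq_le measure_ge0 andbT.
have <- : P x (~` [set w | Z 0 w = x]) = 0%E.
  by rewrite probability_setC // start subee.
apply: le_measure; rewrite ?inE //; first exact: measurableC.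
by move=> w /= -> yx; apply: xy.
Qed.

Definition mean_weight_lim x : R[i] := cexpectation (P x) (fun w =>
  hit_weight_lim g m j s h (fun l => Z (l%:R * h) w)).

Let g_path w l : 0 <= g (Z (l%:R * h) w).
Proof. by rewrite mulr_ge0 // c_ge0 // chain_states. Qed.

Lemma mean_weight_cvg x : states N K x ->
  cbounded_measurable (fun w =>
    hit_weight_lim g m j s h (fun l => Z (l%:R * h) w)) /\
  ccvg (fun L => mean_weight L x) (mean_weight_lim x).
Proof.
move=> sx.
have [] := @ccvg_cexpectation R d T (P x)
  (fun L w => hit_weight g m j s h L (fun l => Z (l%:R * h) w)) (fun w =>
    hit_weight_lim g m j s h (fun l => Z (l%:R * h) w)).
- by move=> L; exact: (hit_weight_measurable L 0).
- by move=> L w; exact: hit_weight_le1.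
- by move=> w; exact: hit_weight_cvg.
move=> mG cvG; split => //.
by apply: ccvg_near cvG; apply: nearW => L; exact: mean_weightE.
Qed.

(** Let the horizon tend to infinity on both sides of the recursion of [mean_weight]; the horizon
    [L.+1] on the left has the same limit as [L]. *)
Lemma mean_weight_lim_eq x : states N K x ->
  mean_weight_lim x = \sum_(y <- E) (p h x y)%:C *
    (if y.1 == m then (y.2 == j)%:R
     else cexp (- s * (h * g y)%:C) * mean_weight_lim y).
Proof.
move=> sx; have [_ /ccvg_shift cv] := mean_weight_cvg sx.
apply: ccvg_unique cv _; apply: ccvg_sum => y; rewrite mem_space_seq => sy.
apply: ccvgM; first exact: ccvg_cst.
case: (y.1 == m); first exact: ccvg_cst.
by apply: ccvgM; [exact: ccvg_cst|case: (mean_weight_cvg sy)].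
Qed.
End FixedStep.
End DiscretizedChain.

(** * The backward equation *)

Section BackwardEquation.
Variables (R : realType) (N : nat) (K : nat -> nat) (q : state -> state -> R).
Variables (d : measure_display) (T : measurableType d).
Variables (P : state -> probability T R) (Z : R -> T -> state).
Hypothesis Z_chain : forall x, states N K x -> markov_chain N K q (P x) Z x.
Variables (c : state -> R) (A : {pred nat}) (m j : nat) (s : R[i]).
Hypothesis c_ge0 : forall x, states N K x -> 0 <= c x.
Hypothesis s_ge0 : 0 <= complex.Re s.
Local Notation E := (space_seq N K).

Definition state_lst (x : state) : R[i] := cexpectation (P x) (fun w =>
  let theta := hitting_time Z m w in
  if (theta < +oo)%E && ((Z (fine theta) w).2 == j)
  then cexp (- s * real_complex R (cost Z c A (fine theta) w)) else 0).

Lemma mean_weight_lim_cvg x : states N K x ->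
  ccvg (fun r => mean_weight_lim P Z c A m j s (harmonic r) x) (state_lst x).
Proof.
move=> sx; have h0 r : 0 <= harmonic r :> R by rewrite invr_ge0.
have [p p_sg p_markov] := chain_common_semigroup Z_chain.
have st w t : 0 <= t -> states N K (Z t w).
  exact: (chain_space (Z_chain sx)).
apply: (proj2 (ccvg_cexpectation _ _ _ _)).
- by move=> r; case: (mean_weight_cvg Z_chain p_markov A m j c_ge0 s_ge0 (h0 r) sx).
- move=> r w; apply: hit_weight_lim_le1 => // l.
  by rewrite mulr_ge0 // c_ge0 // st // mulr_ge0.
- move=> w; apply: (hit_weight_path_cvg (N := N) (K := K)) => //.
    by move=> t t0; exact: (chain_right_continuous (Z_chain sx)).
  by move=> t; exact: st.
Qed.

(* Divide the one-step equation of the chain sampled with step h by h. *)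
Lemma backward_equation x : states N K x -> x.1 != m ->
  \sum_(y <- E) (q x y)%:C *
    (if y.1 == m then (y.2 == j)%:R else state_lst y) =
  s * (c x * (x.1 \in A)%:R)%:C * state_lst x.
Proof.
move=> sx xm; have [p p_sg p_markov] := chain_common_semigroup Z_chain.
pose g (x : state) : R := c x * (x.1 \in A)%:R.
pose u r := mean_weight_lim P Z c A m j s (harmonic r).
pose e r y := cexp (- s * (harmonic r * g y)%:C).
pose W r (y : state) : R[i] := if y.1 == m then (y.2 == j)%:R else e r y * u r y.
have h0 r : 0 < harmonic r :> R by rewrite invr_gt0.
have xE : x \in E by rewrite mem_space_seq.
(* Subtracting [W r x] from the one-step equation replaces [p] by [p] minus the identity. As [x] is
   off level [m], [W r x] is [e r x * u r x], so what remains on the right is the difference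
   quotient of the exponential. *)
have eqn r : \sum_(y <- E) ((p (harmonic r) x y - (x == y)%:R) / harmonic r)%:C *
    W r y = u r x * - ((e r x - 1) * ((harmonic r)^-1)%:C).
  transitivity (((harmonic r)^-1)%:C * (u r x - W r x)); last first.
    by rewrite /W (negPf xm); ring.
  rewrite {1}/u (mean_weight_lim_eq Z_chain p_markov) ?(ltW (h0 r)) //.
  rewrite -[W r x](sum_delta (W r) (space_seq_uniq N K) xE) -sumrB mulr_sumr.
  apply: eq_bigr => y _; rewrite rmorphM rmorphB /=.
  rewrite rmorph_nat -[X in _ = _ * (_ * X - _)]/(W r y); ring.
have cv_e y : ccvg (fun r => e r y) 1.
  rewrite -cexp0; apply: ccvg_cexp; rewrite -(mulr0 (- s)).
  apply: ccvgM; first exact: ccvg_cst.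
  apply: ccvg_real; rewrite -(mul0r (g y)); apply: cvgM; last exact: cvg_cst.
  exact: cvg_harmonic.
have L : ccvg (fun r => \sum_(y <- E)
    ((p (harmonic r) x y - (x == y)%:R) / harmonic r)%:C * W r y)
    (\sum_(y <- E) (q x y)%:C *
      (if y.1 == m then (y.2 == j)%:R else state_lst y)).
  apply: ccvg_sum => y yE; apply: ccvgM.
    apply: ccvg_real.
    have := semigroup_generator_harmonic p_sg ltr01 xE yE.
    by under eq_cvg do rewrite mul1r.
  rewrite /W; case: (y.1 == m); first exact: ccvg_cst.
  rewrite -[state_lst y]mul1r; apply: ccvgM => //.
  by apply: mean_weight_lim_cvg; rewrite -mem_space_seq.
have Rl : ccvg (fun r => u r x * - ((e r x - 1) * ((harmonic r)^-1)%:C))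
    (state_lst x * - (- s * (g x)%:C)).
  apply: ccvgM; first exact: mean_weight_lim_cvg.
  have := ccvgM (ccvg_cst (-1)) (cexp_derivative (- s * (g x)%:C)).
  rewrite mulN1r; apply: ccvg_near; apply: nearW => r.
  rewrite mulN1r /e; congr (- ((cexp _ - 1) * _)); rewrite (rmorphM _ (harmonic r)) /=; ring.
rewrite (ccvg_unique L (ccvg_near _ Rl)); first by rewrite /g; ring.
by apply: nearW => r; rewrite eqn.
Qed.

Lemma cost_lstE n (i : 'I_(K n).+1) (k : 'I_(K m).+1) : k = j :> nat ->
  cost_lst Z K P c A s n m i k = state_lst (n, nat_of_ord i).
Proof. by move=> kj; rewrite mxE kj. Qed.
End BackwardEquation.

(** * Block elimination *)

Section BlockEquations.
Variables (R : realType) (N : nat) (K : nat -> nat) (q : state -> state -> R).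
Variables (d : measure_display) (T : measurableType d).
Variables (P : state -> probability T R) (Z : R -> T -> state).
Variables (c : state -> R) (A : {pred nat}) (s : R[i]).
Local Notation Q n1 n2 := (complex_rate_block K q n1 n2).
Local Notation C n1 n2 := (cost_lst Z K P c A s n1 n2).

(** The row is written [l.+1], so that the lower neighbour always exists and only the upper one can
    fall outside the levels. *)
Lemma sum_tridiagonal (V : nmodType) (G : nat -> V) l : (l < N)%N ->
  (forall n, (n <= N)%N -> (n.+1 < l.+1)%N || (l.+2 < n)%N -> G n = 0) ->
  \sum_(0 <= n < N.+1) G n =
  G l + G l.+1 + (if (l.+1 < N)%N then G l.+2 else 0).
Proof.
move=> lN G0.
rewrite (big_cat_nat (n := l)) //=; last by rewrite leqW // ltnW.
rewrite big_nat big1 ?add0r => [|n /andP[_ nl]]; last first.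
  by apply: G0; [lia|rewrite ltnS nl].
rewrite big_ltn; last by rewrite ltnS ltnW.
rewrite big_ltn // addrA; congr (_ + _).
case: ifP => l1N; last by rewrite big_geq // ltnS; lia.
rewrite big_ltn // big_nat big1 ?addr0 // => n /andP[ln nN].
by apply: G0 => //; rewrite ln orbT.
Qed.

Hypothesis q_gen : ldqbd_generator N K q.
Hypothesis Z_chain : forall x, states N K x -> markov_chain N K q (P x) Z x.
Hypothesis c_ge0 : forall x, states N K x -> 0 <= c x.
Hypothesis s_ge0 : 0 <= complex.Re s.

(** The unknown of the backward equation with its boundary value, the identity, at the target level;
    away from that level it is the transform itself. *)
Definition extended_lst l m : 'M[R[i]]_((K l).+1, (K m).+1) := \matrix_(i, j)
  (if l == m then (nat_of_ord i == j)%:R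
   else state_lst P Z c A m j s (l, nat_of_ord i)).

Lemma extended_lst_id m : extended_lst m m = 1%:M.
Proof. by apply/matrixP => i j; rewrite !mxE eqxx. Qed.

Lemma extended_lst_neq l m : l != m -> extended_lst l m = C l m.
Proof.
by move=> lm; apply/matrixP => i j; rewrite mxE (negPf lm) (@cost_lstE _ _ _ _ _ _ _ _ _ j).
Qed.

(** Only the lower neighbour [l] can be the target level, so the boundary value may enter in that
    block alone. *)
Lemma block_backward l m : (m <= l)%N -> (l < N)%N ->
  Q l.+1 l *m extended_lst l m +
  (Q l.+1 l.+1 - (s * (l.+1 \in A)%:R) *: cost_mx K c l.+1) *m C l.+1 m +
  (if (l.+1 < N)%N then Q l.+1 l.+2 *m C l.+2 m else 0) = 0.
Proof.
move=> ml lN; apply/matrixP => i j.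
have sx : states N K (l.+1, nat_of_ord i).
  by rewrite /states /= lN -ltnS ltn_ord.
have lm : l.+1 != m by rewrite gtn_eqF // ltnS.
have := backward_equation Z_chain A j c_ge0 s_ge0 sx lm.
rewrite big_space_seq (@sum_tridiagonal _ _ l) //=; last first.
  move=> n nN ln; apply: big1 => k _.
  rewrite (rate_level q_gen) ?mul0r //=.
    by rewrite /states /= nN -ltnS ltn_ord.
  by rewrite orbC.
rewrite -!extended_lst_neq // => [H|]; last by rewrite gtn_eqF // ltnS leqW.
have GE n : \sum_(i0 < (K n).+1) (q (l.+1, nat_of_ord i) (n, nat_of_ord i0))%:C *
    (if n == m then (nat_of_ord i0 == j)%:R
     else state_lst P Z c A m j s (n, nat_of_ord i0)) =
    (Q l.+1 n *m extended_lst n m) i j.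
  by rewrite !mxE; apply: eq_bigr => k _; rewrite !mxE.
rewrite !GE in H.
have SE : s * (c (l.+1, nat_of_ord i) * (l.+1 \in A)%:R)%:C *
    state_lst P Z c A m j s (l.+1, nat_of_ord i) =
  (((s * (l.+1 \in A)%:R) *: cost_mx K c l.+1) *m extended_lst l.+1 m) i j.
  rewrite -scalemxAl mxE /cost_mx mul_diag_mx !mxE (negPf lm).
  by rewrite rmorphM /= rmorph_nat; ring.
rewrite SE in H.
rewrite mulmxBl.
have addE (X Y : 'M[R[i]]_((K l.+1).+1, (K m).+1)) :
  (X + Y) i j = X i j + Y i j by rewrite mxE.
have oppE (X : 'M[R[i]]_((K l.+1).+1, (K m).+1)) :
  (- X) i j = - X i j by rewrite mxE.
have zeroE : (0 : 'M[R[i]]_((K l.+1).+1, (K m).+1)) i j = 0 by rewrite mxE.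
move: H; case: ifP => l1N /eqP; rewrite -subr_eq0 => /eqP H.
  rewrite [RHS]zeroE; apply: etrans H; rewrite !addE oppE; ring.
rewrite [RHS]zeroE; apply: etrans H; rewrite !addE oppE zeroE; ring.
Qed.

(** The pivot of the elimination from the top. Without a level above, the coupling term is absent,
    so the same expression covers [M_N] and the [M_m] of lower levels. *)
Definition elimination_mx l : 'M[R[i]]_((K l).+1) :=
  Q l l - (s * (l \in A)%:R) *: cost_mx K c l +
  (if (l < N)%N then Q l l.+1 *m C l.+1 l else 0).

(** Both conclusions are proved together by descent on the level. The factorization one level higher
    absorbs the upper neighbour into the pivot, giving a pivot equation for every target [m] up to
    [l]. For [m] equal to [l] it is the first conclusion; for lower [m] the same inverse and the
    same [Q l.+1 l] appear, whence the factorization. *)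
Lemma block_elimination b l : (b <= l < N)%N ->
  (forall l', (b < l' <= N)%N -> elimination_mx l' \in unitmx) ->
  elimination_mx l.+1 *m C l.+1 l = - Q l.+1 l /\
  forall m, (m < l)%N -> C l.+1 m = C l.+1 l *m C l m.
Proof.
move=> bl uM; have [t tl] := ubnP (N - l)%N.
elim: t => // t IH in l bl tl *.
have lN : (l < N)%N by case/andP: bl.
have eqM m : (m <= l)%N ->
    elimination_mx l.+1 *m C l.+1 m = - (Q l.+1 l *m extended_lst l m).
  move=> ml; have := block_backward ml lN.
  rewrite -addrA => /eqP; rewrite addrC addr_eq0 => /eqP <-.
  rewrite /elimination_mx mulmxDl; congr (_ + _); case: ifP => l1N; last first.
    by rewrite mul0mx.
  have [||_ fac] := IH l.+1; [lia|lia|].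
  by rewrite (fac m) ?ltnS // mulmxA.
have eqMl : elimination_mx l.+1 *m C l.+1 l = - Q l.+1 l.
  by rewrite eqM // extended_lst_id mulmx1.
split=> // m ml.
have uMl : elimination_mx l.+1 \in unitmx by apply: uM; lia.
rewrite -[LHS](mulKmx uMl) -[in RHS](mulKmx uMl (C l.+1 l)) eqMl.
by rewrite eqM ?(ltnW ml) // extended_lst_neq ?gtn_eqF // -mulmxA mulNmx.
Qed.

(** [block_elimination] splits a descent just below its starting level, whereas here the split is
    just above the target; associativity and induction on [n] convert one into the other. *)
Lemma block_factor b n : (b.+1 < n <= N)%N ->
  (forall l', (b < l' <= N)%N -> elimination_mx l' \in unitmx) ->
  C n b = C n b.+1 *m C b.+1 b.
Proof.
move=> + uM; elim: n => // n IH /andP[bn nN].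
have [bn'|->] : (b.+1 < n)%N \/ n = b.+1 by lia.
  have [_ E] := block_elimination (b := b) (l := n) ltac:(lia) uM.
  by rewrite (E b) 1?(E b.+1) 1?IH ?mulmxA //; lia.
have [_ E] := block_elimination (b := b) (l := b.+1) ltac:(lia) uM.
by rewrite (E b).
Qed.
End BlockEquations.

(** * Differentiation of complex matrices *)

(** Differentiability is a first-order expansion, hence local. The formulas for the transforms hold
    only where the pivots are invertible, so they can be used only near the given parameter. *)
Lemma near_eq_differentiable (R : numFieldType) (V W : normedModType R)
    (f g : V -> W) (x : V) :
  {near x, f =1 g} -> differentiable g x -> differentiable f x.
Proof.
move=> fg /diff_locallyP[cg gE].
have fE : f \o shift x = cst (f x) + 'd g x +o_ (0 : V) id.
  apply/eqaddoP => e e0; move/eqaddoP : gE => /(_ _ e0) gE.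
  have fg0 : \forall h \near (0 : V), f (h + x) = g (h + x).
    by have := fg; rewrite (near_shift 0) /= subr0.
  by apply: filterS2 fg0 gE => h; rewrite !fctE /= (nbhs_singleton fg) => ->.
have dfg := diff_unique cg fE.
by apply/diff_locallyP; rewrite dfg; split.
Qed.

Section ComplexDifferentiation.
Variables (R : realType) (p : nat).
Implicit Types (f : 'rV[R]_p -> R[i]) (th : 'rV[R]_p) (l : 'I_p).

(** Full differentiability rather than existence of partial derivatives: it entails the continuity
    that keeps the determinants of the pivots away from 0 near the parameter. *)
Definition cdiff f th : Prop :=
  differentiable (fun u => complex.Re (f u) : R) th /\
  differentiable (fun u => complex.Im (f u) : R) th.

Definition cpartial f th l : R[i] :=
  Complex ('D_(delta_mx 0 l) (fun u => complex.Re (f u) : R) th)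
          ('D_(delta_mx 0 l) (fun u => complex.Im (f u) : R) th).

Lemma cdiff_cst (z : R[i]) th : cdiff (fun=> z) th.
Proof. by split; exact: differentiable_cst. Qed.

Lemma cdiffD f g th : cdiff f th -> cdiff g th -> cdiff (fun u => f u + g u) th.
Proof.
move=> [f1 f2] [g1 g2]; split.
  by under eq_fun do rewrite cReD; exact: differentiableD.
by under eq_fun do rewrite cImD; exact: differentiableD.
Qed.

Lemma cdiffM f g th : cdiff f th -> cdiff g th -> cdiff (fun u => f u * g u) th.
Proof.
move=> [f1 f2] [g1 g2]; split.
  by under eq_fun do rewrite cReM; apply: differentiableB; exact: differentiableM.
by under eq_fun do rewrite cImM; apply: differentiableD; exact: differentiableM.
Qed.

Lemma cdiff_sum (I : Type) (s : seq I) (F : I -> 'rV[R]_p -> R[i]) th :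
  (forall i, cdiff (F i) th) -> cdiff (fun u => \sum_(i <- s) F i u) th.
Proof.
move=> H; elim: s => [|i s IH].
  by under eq_fun do rewrite big_nil; exact: cdiff_cst.
by under eq_fun do rewrite big_cons; exact: cdiffD.
Qed.

Lemma cdiff_prod (I : Type) (s : seq I) (F : I -> 'rV[R]_p -> R[i]) th :
  (forall i, cdiff (F i) th) -> cdiff (fun u => \prod_(i <- s) F i u) th.
Proof.
move=> H; elim: s => [|i s IH].
  by under eq_fun do rewrite big_nil; exact: cdiff_cst.
by under eq_fun do rewrite big_cons; exact: cdiffM.
Qed.

Lemma sqr_norm_gt0 (z : R[i]) :
  (0 < complex.Re z ^+ 2 + complex.Im z ^+ 2) = (z != 0).
Proof.
rewrite lt_def addr_ge0 ?sqr_ge0 // andbT paddr_eq0 ?sqr_ge0 //.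
by rewrite !sqrf_eq0 eq_complex.
Qed.

Lemma sqr_norm_diff f th : cdiff f th ->
  differentiable (fun u => complex.Re (f u) ^+ 2 + complex.Im (f u) ^+ 2 : R) th.
Proof.
move=> [f1 f2]; under eq_fun do rewrite !expr2.
by apply: differentiableD; exact: differentiableM.
Qed.

Lemma cdiffV f th : cdiff f th -> f th != 0 -> cdiff (fun u => (f u)^-1) th.
Proof.
move=> df f0; have dN := sqr_norm_diff df; have [f1 f2] := df.
have dV : differentiable (fun u : 'rV[R]_p =>
    (complex.Re (f u) ^+ 2 + complex.Im (f u) ^+ 2)^-1 : R) th.
  by apply: differentiableV => //; rewrite gt_eqF // sqr_norm_gt0.
split.
  rewrite (_ : (fun u => _) = (fun u => complex.Re (f u) *
    (complex.Re (f u) ^+ 2 + complex.Im (f u) ^+ 2)^-1)).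
    exact: differentiableM.
  by apply/funext => u; case: (f u).
rewrite (_ : (fun u => _) = (fun u => - (complex.Im (f u) *
  (complex.Re (f u) ^+ 2 + complex.Im (f u) ^+ 2)^-1))).
  by apply: differentiableN; exact: differentiableM.
by apply/funext => u; case: (f u).
Qed.

Lemma cdiff_near_neq0 f th : cdiff f th -> f th != 0 ->
  \forall u \near th, f u != 0.
Proof.
move=> /sqr_norm_diff /differentiable_continuous cN.
rewrite -sqr_norm_gt0 => f0; have : \forall u \near th,
    0 < complex.Re (f u) ^+ 2 + complex.Im (f u) ^+ 2.
  by apply: cvgr_gt _ cN _ f0.
by apply: filterS => u; rewrite sqr_norm_gt0.
Qed.

Lemma near_eq_cdiff f g th : {near th, f =1 g} -> cdiff g th -> cdiff f th.
Proof.
move=> fg [g1 g2]; split; [apply: near_eq_differentiable g1|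
  apply: near_eq_differentiable g2]; by apply: filterS fg => u ->.
Qed.

Lemma near_eq_cpartial f g th l : {near th, f =1 g} ->
  cpartial f th l = cpartial g th l.
Proof.
by move=> fg; congr Complex; apply: near_eq_derive; apply: filterS fg => u ->.
Qed.

Lemma cpartial_cst (z : R[i]) th l : cpartial (fun=> z) th l = 0.
Proof. by congr Complex; exact: derive_cst. Qed.

Lemma cpartialD f g th l : cdiff f th -> cdiff g th ->
  cpartial (fun u => f u + g u) th l = cpartial f th l + cpartial g th l.
Proof.
move=> [f1 f2] [g1 g2]; apply: complex_ext; rewrite ?cReD ?cImD /=.
  under eq_fun do rewrite cReD.
  by apply: deriveD; exact: diff_derivable.
under eq_fun do rewrite cImD.
by apply: deriveD; exact: diff_derivable.
Qed.

Lemma cpartialM f g th l : cdiff f th -> cdiff g th ->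
  cpartial (fun u => f u * g u) th l =
  cpartial f th l * g th + f th * cpartial g th l.
Proof.
move=> [f1 f2] [g1 g2].
have [Df1 Df2 Dg1 Dg2] :
    [/\ derivable (fun u => complex.Re (f u) : R) th (delta_mx 0 l),
    derivable (fun u => complex.Im (f u) : R) th (delta_mx 0 l),
    derivable (fun u => complex.Re (g u) : R) th (delta_mx 0 l) &
    derivable (fun u => complex.Im (g u) : R) th (delta_mx 0 l)].
  by split; exact: diff_derivable.
apply: complex_ext; rewrite ?cReD ?cImD ?cReM ?cImM /=.
  under eq_fun do rewrite cReM.
  apply: etrans (deriveB (derivableM Df1 Dg1) (derivableM Df2 Dg2)) _.
  rewrite (deriveM Df1 Dg1) (deriveM Df2 Dg2) /GRing.scale /=; ring.
under eq_fun do rewrite cImM.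
apply: etrans (deriveD (derivableM Df1 Dg2) (derivableM Df2 Dg1)) _.
rewrite (deriveM Df1 Dg2) (deriveM Df2 Dg1) /GRing.scale /=; ring.
Qed.

Lemma cpartial_sum (I : Type) (s : seq I) (F : I -> 'rV[R]_p -> R[i]) th l :
  (forall i, cdiff (F i) th) ->
  cpartial (fun u => \sum_(i <- s) F i u) th l =
  \sum_(i <- s) cpartial (F i) th l.
Proof.
move=> H; elim: s => [|i s IH].
  under eq_fun do rewrite big_nil.
  by rewrite big_nil cpartial_cst.
under eq_fun do rewrite big_cons.
by rewrite big_cons cpartialD ?IH //; exact: cdiff_sum.
Qed.
End ComplexDifferentiation.

(** * Matrix-valued functions and their gradients *)

Section MatrixDifferentiation.
Variables (R : realType) (p : nat).
Implicit Types (th : 'rV[R]_p) (l : 'I_p).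

Definition mxdiff a b (F : 'rV[R]_p -> 'M[R[i]]_(a, b)) th : Prop :=
  forall i j, cdiff (fun u => F u i j) th.

Lemma mxdiff_has_partials a b (F : 'rV[R]_p -> 'M[R[i]]_(a, b)) th :
  mxdiff F th -> has_partials F th.
Proof.
by move=> dF l i j; have [d1 d2] := dF i j; split; exact: diff_derivable.
Qed.

Lemma partial_mxE a b (F : 'rV[R]_p -> 'M[R[i]]_(a, b)) th l i j :
  partial_mx F th l i j = cpartial (fun u => F u i j) th l.
Proof. by rewrite mxE. Qed.

Lemma near_eq_mxdiff a b (F G : 'rV[R]_p -> 'M[R[i]]_(a, b)) th :
  {near th, F =1 G} -> mxdiff G th -> mxdiff F th.
Proof.
move=> FG dG i j; apply: near_eq_cdiff (dG i j).
by apply: filterS FG => u ->.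
Qed.

Lemma near_eq_partial_mx a b (F G : 'rV[R]_p -> 'M[R[i]]_(a, b)) th l :
  {near th, F =1 G} -> partial_mx F th l = partial_mx G th l.
Proof.
move=> FG; apply/matrixP => i j; rewrite !partial_mxE.
by apply: near_eq_cpartial; apply: filterS FG => u ->.
Qed.

Lemma mxdiffD a b (F G : 'rV[R]_p -> 'M[R[i]]_(a, b)) th :
  mxdiff F th -> mxdiff G th -> mxdiff (fun u => F u + G u) th.
Proof.
by move=> dF dG i j; under eq_fun do rewrite mxE; exact: cdiffD.
Qed.

Lemma mxdiff_cst a b (B : 'M[R[i]]_(a, b)) th : mxdiff (fun=> B) th.
Proof. by move=> i j; exact: cdiff_cst. Qed.

Lemma mxdiffM a b e (F : 'rV[R]_p -> 'M[R[i]]_(a, b))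
    (G : 'rV[R]_p -> 'M[R[i]]_(b, e)) th :
  mxdiff F th -> mxdiff G th -> mxdiff (fun u => F u *m G u) th.
Proof.
move=> dF dG i j; under eq_fun do rewrite mxE.
by apply: cdiff_sum => k; exact: cdiffM.
Qed.

Lemma mxdiff_det a (F : 'rV[R]_p -> 'M[R[i]]_a) th :
  mxdiff F th -> cdiff (fun u => \det (F u)) th.
Proof.
move=> dF; rewrite /determinant; apply: cdiff_sum => sg.
by apply: cdiffM; [exact: cdiff_cst|apply: cdiff_prod => i].
Qed.

Lemma near_unitmx a (F : 'rV[R]_p -> 'M[R[i]]_a) th :
  mxdiff F th -> F th \in unitmx -> \forall u \near th, F u \in unitmx.
Proof.
move=> /mxdiff_det dF; rewrite unitmxE unitfE => F0.
have := cdiff_near_neq0 dF F0.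
by apply: filterS => u; rewrite unitmxE unitfE.
Qed.

Lemma mxdiffV a (F : 'rV[R]_p -> 'M[R[i]]_a) th :
  mxdiff F th -> F th \in unitmx -> mxdiff (fun u => invmx (F u)) th.
Proof.
(* [invmx] follows the adjugate formula only on invertible matrices, so invertibility on a
   neighbourhood comes first; the entries are then rational functions of those of [F]. *)
move=> dF uF; apply: (@near_eq_mxdiff _ _ _
  (fun u => (\det (F u))^-1 *: \adj (F u))).
  by have := near_unitmx dF uF; apply: filterS => u; rewrite /invmx => ->.
move=> i j; under eq_fun do rewrite mxE; apply: cdiffM.
  by apply: cdiffV; [exact: mxdiff_det|rewrite -unitfE -unitmxE].
under eq_fun do rewrite mxE; apply: cdiffM; first exact: cdiff_cst.
apply: mxdiff_det => i' j'.
by under eq_fun do rewrite !mxE.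
Qed.

Lemma partial_mxD a b (F G : 'rV[R]_p -> 'M[R[i]]_(a, b)) th l :
  mxdiff F th -> mxdiff G th ->
  partial_mx (fun u => F u + G u) th l = partial_mx F th l + partial_mx G th l.
Proof.
move=> dF dG; apply/matrixP => i j; rewrite partial_mxE mxE !partial_mxE.
by under eq_fun do rewrite mxE; exact: cpartialD.
Qed.

Lemma partial_mx_cst a b (B : 'M[R[i]]_(a, b)) th l :
  partial_mx (fun=> B) th l = 0.
Proof. by apply/matrixP => i j; rewrite partial_mxE mxE cpartial_cst. Qed.

Lemma partial_mxM a b e (F : 'rV[R]_p -> 'M[R[i]]_(a, b))
    (G : 'rV[R]_p -> 'M[R[i]]_(b, e)) th l :
  mxdiff F th -> mxdiff G th ->
  partial_mx (fun u => F u *m G u) th l =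
  partial_mx F th l *m G th + F th *m partial_mx G th l.
Proof.
move=> dF dG; apply/matrixP => i j; rewrite partial_mxE.
under eq_fun do rewrite mxE.
rewrite cpartial_sum => [|k]; last exact: cdiffM.
rewrite !mxE -big_split; apply: eq_bigr => k _.
by rewrite cpartialM // !partial_mxE.
Qed.

Lemma partial_mxN a b (F : 'rV[R]_p -> 'M[R[i]]_(a, b)) th l :
  mxdiff F th -> partial_mx (fun u => - F u) th l = - partial_mx F th l.
Proof.
move=> dF; have E u : - F u = (- 1)%:M *m F u by rewrite mul_scalar_mx scaleN1r.
under [X in partial_mx X]eq_fun do rewrite E.
rewrite (partial_mxM l (mxdiff_cst _ th) dF) partial_mx_cst.
by rewrite mul0mx add0r mul_scalar_mx scaleN1r.
Qed.

(** Differentiate the product [M C = - B] and solve for the derivative of [C]; the derivative of the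
    inverse never has to be computed. *)
Lemma partial_mx_solve a b (M : 'rV[R]_p -> 'M[R[i]]_a)
    (B C : 'rV[R]_p -> 'M[R[i]]_(a, b)) th l :
  mxdiff M th -> mxdiff B th -> mxdiff C th -> M th \in unitmx ->
  (\forall u \near th, M u *m C u = - B u) ->
  partial_mx C th l = invmx (M th) *m partial_mx M th l *m invmx (M th) *m B th
    - invmx (M th) *m partial_mx B th l.
Proof.
move=> dM dB dC uM MC.
have Cth : C th = - (invmx (M th) *m B th).
  by rewrite -mulmxN -(nbhs_singleton MC) mulKmx.
have := partial_mxM l dM dC.
rewrite (near_eq_partial_mx l MC) (partial_mxN l dB) => H.
have -> : partial_mx C th l = invmx (M th) *m (M th *m partial_mx C th l).
  by rewrite mulKmx.
have -> : M th *m partial_mx C th l = - partial_mx B th l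
    - partial_mx M th l *m C th by rewrite H addrC addKr.
by rewrite Cth mulmxN opprK mulmxDr mulmxN addrC !mulmxA.
Qed.

Definition mxconcat a b (F : 'I_p -> 'M[R[i]]_(a, b)) : 'M[R[i]]_(a, p * b) :=
  \matrix_(i, lj) F (mxtens_unindex lj).1 i (mxtens_unindex lj).2.

Lemma gradient_mxE a b (F : 'rV[R]_p -> 'M[R[i]]_(a, b)) th :
  gradient_mx F th = mxconcat (partial_mx F th).
Proof. by []. Qed.

Lemma mxconcatD a b (F G : 'I_p -> 'M[R[i]]_(a, b)) :
  mxconcat F + mxconcat G = mxconcat (fun l => F l + G l).
Proof. by apply/matrixP => i j; rewrite !mxE. Qed.

Lemma mxconcatB a b (F G : 'I_p -> 'M[R[i]]_(a, b)) :
  mxconcat F - mxconcat G = mxconcat (fun l => F l - G l).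
Proof. by apply/matrixP => i j; rewrite !mxE. Qed.

Lemma mulmx_concat a b e (B : 'M[R[i]]_(a, b)) (F : 'I_p -> 'M[R[i]]_(b, e)) :
  B *m mxconcat F = mxconcat (fun l => B *m F l).
Proof.
by apply/matrixP => i j; rewrite !mxE; apply: eq_bigr => k _; rewrite mxE.
Qed.

(** The Kronecker factor is block diagonal with [p] copies of [B]. Together with [mulmx_concat] this
    reduces each gradient identity to one identity per parameter. *)
Lemma mxconcat_tens a b e (F : 'I_p -> 'M[R[i]]_(a, b)) (B : 'M[R[i]]_(b, e)) :
  mxconcat F *m ((1%:M : 'M[R[i]]_p) *t B) = mxconcat (fun l => F l *m B).
Proof.
apply/matrixP => i lj; rewrite !mxE.
case: (mxtens_indexP lj) => l j; rewrite mxtens_indexK /=.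
(* Splitting the summation index into a block and a position leaves, by the identity factor, the
   single block [l]. *)
rewrite (reindex (@mxtens_index p b)) /=; last first.
  exists (@mxtens_unindex p b) => x _; first exact: mxtens_indexK.
  exact: mxtens_unindexK.
pose G l' k := mxconcat F i (mxtens_index (l', k)) *
  ((1%:M : 'M[R[i]]_p) *t B) (mxtens_index (l', k)) (mxtens_index (l, j)).
rewrite (eq_bigr (fun x => G x.1 x.2)) => [|[l' k] _ //].
rewrite -(pair_bigA _ G) /G /=.
rewrite (bigD1 l) //= [X in _ + X]big1 ?addr0 => [|l' ll'].
  by apply: eq_bigr => k _; rewrite mxE tensmxE mxtens_indexK mxE eqxx mul1r.
by rewrite big1 // => k _; rewrite tensmxE [1%:M _ _]mxE (negPf ll') mul0r mulr0.
Qed.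
End MatrixDifferentiation.

(** * Dependence on the parameters *)

Section ParametricChain.
Variables (R : realType) (p N : nat) (K : nat -> nat).
Variables (Theta : set 'rV[R]_p) (q : 'rV[R]_p -> state -> state -> R).
Variables (c : state -> R) (A : {pred nat}).
Variables (d : measure_display) (T : measurableType d).
Variables (P : 'rV[R]_p -> state -> probability T R).
Variables (Z : 'rV[R]_p -> R -> T -> state) (s : R[i]) (th : 'rV[R]_p) (b : nat).
Hypotheses (Theta_open : open Theta)
  (q_generator : forall u, Theta u -> ldqbd_generator N K (q u))
  (q_diff : forall u n1 n2, Theta u -> (n1 <= N)%N -> (n2 <= N)%N ->
    differentiable (fun v => rate_block K (q v) n1 n2) u)
  (c_ge0 : forall x, states N K x -> 0 <= c x)
  (Z_chain : forall u x, Theta u -> states N K x ->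
    markov_chain N K (q u) (P u x) (Z u) x)
  (s_ge0 : 0 <= complex.Re s) (th_in : Theta th).
Local Notation Q n1 n2 := (fun u => complex_rate_block K (q u) n1 n2).
Local Notation C n1 n2 := (fun u => cost_lst (Z u) K (P u) c A s n1 n2).
Local Notation M l := (fun u => elimination_mx N K (q u) (P u) (Z u) c A s l).
Hypothesis M_unit : forall l, (b < l <= N)%N -> M l th \in unitmx.

Lemma rate_block_mxdiff n1 n2 : (n1 <= N)%N -> (n2 <= N)%N ->
  mxdiff (Q n1 n2) th.
Proof.
move=> n1N n2N i j; split; last first.
  rewrite (_ : (fun u => _) = cst 0); first exact: differentiable_cst.
  by apply/funext => u; rewrite !mxE.
rewrite (_ : (fun u => _) = (fun X : 'M[R]_((K n1).+1, (K n2).+1) => X i j) \o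
    (fun u => rate_block K (q u) n1 n2)); last first.
  by apply/funext => u; rewrite /= !mxE.
apply: differentiable_comp; first exact: q_diff.
exact: differentiable_coord.
Qed.

Lemma near_Theta : \forall u \near th, Theta u.
Proof. exact: open_nbhs_nbhs. Qed.

(** The three claims feed each other during the descent: differentiability of the transform one
    level higher makes the pivot differentiable, hence invertible nearby, and near [th] the next
    transform is then the inverse pivot times [- Q l.+1 l]. *)
Lemma elimination_mxdiff l : (b <= l < N)%N ->
  [/\ \forall u \near th, forall l', (l < l' <= N)%N -> M l' u \in unitmx,
    mxdiff (M l.+1) th & mxdiff (C l.+1 l) th].
Proof.
move=> bl; have [t tl] := ubnP (N - l)%N.
elim: t => // t IH in l bl tl *.
have lN : (l < N)%N by case/andP: bl.
have dM : mxdiff (M l.+1) th.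
  apply: mxdiffD.
    apply: mxdiffD; first exact: rate_block_mxdiff.
    exact: mxdiff_cst.
  have [l1N|l1N] := ltnP l.+1 N; last exact: mxdiff_cst.
  have [||_ _ dC] := IH l.+1; [lia|lia|].
  by apply: mxdiffM => //; apply: rate_block_mxdiff.
have near_unit : \forall u \near th,
    forall l', (l < l' <= N)%N -> M l' u \in unitmx.
  have uM : M l.+1 th \in unitmx by apply: M_unit; lia.
  have nu := near_unitmx dM uM.
  have [l1N|l1N] := ltnP l.+1 N; last first.
    apply: filterS nu => u uu l' ll'; have -> : l' = l.+1 by lia.
    exact: uu.
  have [||nu' _ _] := IH l.+1; [lia|lia|].
  apply: filterS2 nu nu' => u uu uu' l' ll'.
  have [->|ll''] := eqVneq l' l.+1; first exact: uu.
  by apply: uu'; lia.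
split=> //.
apply: (@near_eq_mxdiff _ _ _ _ _ (fun u => invmx (M l.+1 u) *m (- Q l.+1 l u))).
  apply: filterS2 near_Theta near_unit => u uTheta uu.
  have [|<- _] := block_elimination (q_generator uTheta)
    (fun x => Z_chain (x := x) uTheta) c_ge0 s_ge0 (b := l) (l := l) _ uu.
    by rewrite leqnn.
  by rewrite mulKmx // uu // ltnSn.
apply: mxdiffM; first by apply: mxdiffV => //; apply: M_unit; lia.
have dQ : mxdiff (Q l.+1 l) th by apply: rate_block_mxdiff => //; exact: ltnW.
rewrite (_ : (fun u => _) = (fun u => (-1)%:M *m Q l.+1 l u)).
  by apply: mxdiffM => //; exact: mxdiff_cst.
by apply/funext => u; rewrite mul_scalar_mx scaleN1r.
Qed.

(** Near [th] the transform is a product of one-level transforms, from which the topmost factor is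
    peeled off. *)
Lemma cost_lst_mxdiff n : (b < n <= N)%N -> mxdiff (C n b) th.
Proof.
elim: n => // n IH bn; have bn' : (b <= n < N)%N by lia.
have [nu _ dC] := elimination_mxdiff bn'.
have [nb|nb] := eqVneq n b; first by move: dC; rewrite nb.
apply: (@near_eq_mxdiff _ _ _ _ _ (fun u => C n.+1 n u *m C n b u)).
  apply: filterS2 near_Theta nu => u uTheta uu.
  have [|_ fac] := block_elimination (q_generator uTheta)
    (fun x => Z_chain (x := x) uTheta) c_ge0 s_ge0 (b := n) (l := n) _ uu.
  - by lia.
  - by apply: fac; lia.
by apply: mxdiffM => //; apply: IH; lia.
Qed.

Lemma near_cost_lst_factor n : (b.+1 < n <= N)%N ->
  \forall u \near th, C n b u = C n b.+1 u *m C b.+1 b u.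
Proof.
move=> bn; have [|nu _ _] := @elimination_mxdiff b; first by lia.
apply: filterS2 near_Theta nu => u uTheta uu.
exact: (block_factor (q_generator uTheta) (fun x => Z_chain (x := x) uTheta)).
Qed.

Lemma near_elimination l : (b <= l < N)%N ->
  \forall u \near th, M l.+1 u *m C l.+1 l u = - Q l.+1 l u.
Proof.
move=> bl; have [nu _ _] := elimination_mxdiff bl.
apply: filterS2 near_Theta nu => u uTheta uu.
have [|-> //] := block_elimination (q_generator uTheta)
  (fun x => Z_chain (x := x) uTheta) c_ge0 s_ge0 (b := l) (l := l) _ uu.
by lia.
Qed.

(** One formula serves all levels, in terms of the gradient of the pivot; the top level and the
    lower ones differ only in how that gradient expands. *)
Lemma gradient_cost_lst l : (b <= l < N)%N ->
  gradient_mx (C l.+1 l) th = invmx (M l.+1 th) *m gradient_mx (M l.+1) th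
    *m ((1%:M : 'M[R[i]]_p) *t invmx (M l.+1 th))
    *m ((1%:M : 'M[R[i]]_p) *t Q l.+1 l th)
  - invmx (M l.+1 th) *m gradient_mx (Q l.+1 l) th.
Proof.
move=> bl; have [_ dM dC] := elimination_mxdiff bl.
rewrite !gradient_mxE !mulmx_concat !mxconcat_tens mxconcatB.
congr mxconcat; apply/funext => t.
apply: partial_mx_solve => //; first by apply: rate_block_mxdiff; lia.
  by apply: M_unit; lia.
exact: near_elimination.
Qed.
Lemma partial_mx_diagonal_block l t : (l <= N)%N ->
  partial_mx (fun u => Q l l u - (s * (l \in A)%:R) *: cost_mx K c l) th t =
  partial_mx (Q l l) th t.
Proof.
move=> lN; rewrite partial_mxD ?partial_mx_cst ?addr0 //.
exact: rate_block_mxdiff.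
Qed.

Lemma gradient_elimination_top : gradient_mx (M N) th = gradient_mx (Q N N) th.
Proof.
rewrite !gradient_mxE; congr mxconcat; apply/funext => t.
rewrite -(partial_mx_diagonal_block t (leqnn N)) /elimination_mx ltnn.
by under [X in partial_mx X _ _ = _]eq_fun do rewrite addr0.
Qed.

Lemma gradient_elimination l : (b < l < N)%N ->
  gradient_mx (M l) th = gradient_mx (Q l l) th
    + gradient_mx (Q l l.+1) th *m ((1%:M : 'M[R[i]]_p) *t C l.+1 l th)
    + Q l l.+1 th *m gradient_mx (C l.+1 l) th.
Proof.
move=> bl; have lN : (l < N)%N by case/andP: bl.
have [|_ _ dC] := @elimination_mxdiff l; first by lia.
have dQ : mxdiff (Q l l.+1) th by apply: rate_block_mxdiff; lia.
rewrite !gradient_mxE mxconcat_tens mulmx_concat !mxconcatD.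
congr mxconcat; apply/funext => t.
rewrite -addrA -(partial_mxM t dQ dC) -(partial_mx_diagonal_block t (ltnW lN)).
rewrite -partial_mxD; last exact: mxdiffM.
  by rewrite /elimination_mx lN.
apply: mxdiffD; last exact: mxdiff_cst.
by apply: rate_block_mxdiff; lia.
Qed.
End ParametricChain.

Theorem lemma3
  (R : realType) (p N : nat) (K : nat -> nat)
  (Theta : set 'rV[R]_p) (q : 'rV[R]_p -> state -> state -> R)
  (c : state -> R) (A : {pred nat})
  (d : measure_display) (T : measurableType d)
  (P : 'rV[R]_p -> state -> probability T R)
  (Z : 'rV[R]_p -> R -> T -> state)
  (s : R[i]) (th : 'rV[R]_p) (n k : nat)
  (Theta_open : open Theta)
  (q_generator : forall u, Theta u -> ldqbd_generator N K (q u))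
  (q_diff : forall u n1 n2, Theta u -> (n1 <= N)%N -> (n2 <= N)%N ->
    differentiable (fun v => rate_block K (q v) n1 n2) u)
  (c_ge0 : forall x, states N K x -> 0 <= c x)
  (A_levels : forall m, m \in A -> (m <= N)%N)
  (Z_chain : forall u x, Theta u -> states N K x ->
    markov_chain N K (q u) (P u x) (Z u) x)
  (s_ge0 : 0 <= complex.Re s)
  (th_in : Theta th)
  (n_range : (1 <= n <= N)%N)
  (k_range : (2 <= k <= n)%N) :
  let Q n1 n2 := fun u => complex_rate_block K (q u) n1 n2 in
  let C n1 n2 := fun u => cost_lst (Z u) K (P u) c A s n1 n2 in
  let I_ox a b (B : 'M[R[i]]_(a, b)) := (1%:M : 'M[R[i]]_p) *t B in
  let M_N := Q N N th - (s * (N \in A)%:R) *: cost_mx K c N in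
  let M m := Q m m th - (s * (m \in A)%:R) *: cost_mx K c m
             + Q m m.+1 th *m C m.+1 m th in
  M_N \in unitmx ->
  (forall m, (n - k + 1 <= m <= N - 1)%N -> M m \in unitmx) ->
  [/\ has_partials (C n (n - k)%N) th /\
      gradient_mx (C n (n - k)%N) th =
        gradient_mx (C n (n - k).+1) th
          *m I_ox _ _ (C (n - k).+1 (n - k)%N th)
        + C n (n - k).+1 th *m gradient_mx (C (n - k).+1 (n - k)%N) th,
      has_partials (C N N.-1) th /\
      gradient_mx (C N N.-1) th =
        invmx M_N *m gradient_mx (Q N N) th
          *m I_ox _ _ (invmx M_N) *m I_ox _ _ (Q N N.-1 th)
        - invmx M_N *m gradient_mx (Q N N.-1) th
    & forall m, (n - k + 1 <= m <= N - 1)%N ->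
      has_partials (C m m.-1) th /\
      gradient_mx (C m m.-1) th =
        invmx (M m)
          *m (gradient_mx (Q m m) th
              + gradient_mx (Q m m.+1) th *m I_ox _ _ (C m.+1 m th)
              + Q m m.+1 th *m gradient_mx (C m.+1 m) th)
          *m I_ox _ _ (invmx (M m)) *m I_ox _ _ (Q m m.-1 th)
        - invmx (M m) *m gradient_mx (Q m m.-1) th].
Proof.
case: N q_generator q_diff A_levels Z_chain n_range c_ge0 =>
  [|N'] q_gen q_dif _ Z_ch n_le c0; first by lia.
move=> Q C I_ox M_N M uN uM.
pose b := (n - k)%N.
pose E l u := elimination_mx N'.+1 K (q u) (P u) (Z u) c A s l.
have EN : E N'.+1 th = M_N by rewrite /E /elimination_mx ltnn addr0.
have EM m : (m < N'.+1)%N -> E m th = M m.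
  by move=> mN; rewrite /E /elimination_mx mN.
(* The two invertibility hypotheses together cover exactly the pivots above level [n - k]. *)
have uE l : (b < l <= N'.+1)%N -> E l th \in unitmx.
  move=> bl; have [->|lN] := eqVneq l N'.+1; first by rewrite EN.
  by rewrite EM ?uM //; lia.
have uE1 l : (b.+1 < l <= N'.+1)%N -> E l th \in unitmx.
  by move=> bl; apply: uE; lia.
have dC l := cost_lst_mxdiff Theta_open q_gen q_dif c0 Z_ch s_ge0 th_in uE
  (n := l).
have dE l := elimination_mxdiff Theta_open q_gen q_dif c0 Z_ch s_ge0 th_in uE
  (l := l).
have gC l := gradient_cost_lst Theta_open q_gen q_dif c0 Z_ch s_ge0 th_in uE
  (l := l).
split.
- have bn : (b.+1 < n <= N'.+1)%N by lia.
  have dC0 : mxdiff (C n b) th by apply: dC; lia.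
  (* For the target level [b.+1] the general result is applied with bound [b.+1], hence with
     [uE1]. *)
  have dC1 : mxdiff (C n b.+1) th.
    exact: (cost_lst_mxdiff Theta_open q_gen q_dif c0 Z_ch s_ge0 th_in uE1 bn).
  have dCb : mxdiff (C b.+1 b) th by apply: dC; lia.
  split; first exact: mxdiff_has_partials.
  rewrite !gradient_mxE mxconcat_tens mulmx_concat mxconcatD.
  congr mxconcat; apply/funext => t; rewrite -partial_mxM //.
  apply: near_eq_partial_mx.
  exact: (near_cost_lst_factor Theta_open q_gen q_dif c0 Z_ch s_ge0 th_in uE bn).
- have bN : (b <= N' < N'.+1)%N by lia.
  have [_ _ dCN] := dE _ bN.
  split; first exact: mxdiff_has_partials.
  have := gC _ bN; rewrite (gradient_elimination_top _ _ _ _ _ q_dif th_in) => ->.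
  by rewrite -/(E _ _) EN.
- move=> [|l] bl; first by lia.
  have bl' : (b <= l < N'.+1)%N by lia.
  have [_ _ dCl] := dE _ bl'.
  split; first exact: mxdiff_has_partials.
  have := gC _ bl'.
  rewrite (gradient_elimination Theta_open q_gen q_dif c0 Z_ch s_ge0 th_in uE);
    last by lia.
  move=> ->; rewrite -/(E _ _) EM //; lia.
Qed.
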